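(* There exists an absolute constant $c$ such that the following holds. Let $\Lambda$ be the generator of an ergodic continuous-time Markov chain with finite state space $[n]$, $n\ge2$, and stationary distribution $\pi$. Let $0<\epsilon\le1/8$ and let $T=T(\epsilon)$ be its $\epsilon$-mixing time. Let $\{v_t:t\in\mathbb{R}^+\}$ be a random walk on the chain starting from an initial distribution $\varphi$, where $v_t$ is the state of the walk at time $t$. Let $\{f_t:[n]\to[0,1]\mid t\in\mathbb{R}^+\}$ be a family of functions such that $\mu=\mathrm{E}_{v\leftarrow\pi}[f_t(v)]$ for all $t$, and such that $s\mapsto f_s(j)$ is measurable for each $j\in[n]$. Define the weight of the walk up to time $t$ by $X_t=\int_0^t f_s(v_s)\,ds$. Then: 1. $\Pr[X_t\ge(1+\delta)\mu t]\le c\,\|\varphi\|_\pi\exp\left(-\delta^2\mu t/(72T)\right)$ for $0\le\delta\le1$, and $\Pr[X_t\ge(1+\delta)\mu t]\le c\,\|\varphi\|_\pi\exp\left(-\delta\mu t/(72T)\right)$ for $\delta>1$; 2. $\Pr[X_t\le(1-\delta)\mu t]\le c\,\|\varphi\|_\pi\exp\left(-\delta^2\mu t/(72T)\right)$ for $0\le\delta\le1$.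
   Context: For a continuous-time chain with generator $\Lambda$, $M(t)=e^{t\Lambda}$ is the transition probability matrix from time $t_0$ to $t_0+t$ (for any $t_0$); distributions are row vectors. Total variation distance: $\|u-w\|_{TV}=\max_{A\subseteq[n]}|\sum_{i\in A}u_i-\sum_{i\in A}w_i|=\frac12\|u-w\|_1$. The $\epsilon$-mixing time is $T(\epsilon)=\min\{t\ge0:\max_x\|xM(t)-\pi\|_{TV}\le\epsilon\}$, where $x$ ranges over all probability distributions on $[n]$. The inner product under the $\pi$-kernel on $\mathbb{R}^n$ is $\langle u,v\rangle_\pi=\sum_{i\in[n]}u_iv_i/\pi(i)$, and the $\pi$-norm is $\|u\|_\pi=\sqrt{\langle u,u\rangle_\pi}$. *)

(* Defs.v *)
From HB Require Import structures.
From mathcomp Require Import all_boot all_order all_algebra.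
From mathcomp Require Import all_classical all_reals all_analysis.
Import Order.TTheory GRing.Theory Num.Theory numFieldNormedType.Exports.

Set Implicit Arguments.
Unset Strict Implicit.
Unset Printing Implicit Defensive.

Local Open Scope classical_set_scope.
Local Open Scope ring_scope.

Definition is_distribution (R : realType) (n : nat) (x : 'rV[R]_n) : Prop :=
  (forall i, 0 <= x 0 i) /\ \sum_i x 0 i = 1.

Definition is_generator (R : realType) (n : nat) (L : 'M[R]_n) : Prop :=
  (forall i j, i != j -> 0 <= L i j) /\ (forall i, \sum_j L i j = 0).

(* For a finite continuous-time chain, ergodicity is irreducibility (there is
   no periodicity): every state is reachable from every other one through
   transitions of positive rate. *)
Definition ergodic (R : realType) (n : nat) (L : 'M[R]_n) : Prop :=
  forall i j, connect [rel a b | (a != b) && (0 < L a b)] i j.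

Definition is_stationary (R : realType) (n : nat) (L : 'M[R]_n)
    (pi : 'rV[R]_n) : Prop :=
  is_distribution pi /\ pi *m L = 0.

(* The matrix exponential exp(t L); the limit is in the (entrywise) topology
   of 'M[R]_n. *)
Definition transition (R : realType) (n : nat) (L : 'M[R]_n) (t : R) : 'M[R]_n :=
  limn (series (fun k : nat => (t ^+ k / k`!%:R) *: L ^+ k)).

Definition tv_dist (R : realType) (n : nat) (u w : 'rV[R]_n) : R :=
  \big[Num.max/0]_(A : {set 'I_n})
    `| \sum_(i in A) u 0 i - \sum_(i in A) w 0 i |.

(* For an ergodic L and eps > 0 this set is nonempty and closed, so that the
   infimum is a minimum. *)
Definition mixing_time (R : realType) (n : nat) (L : 'M[R]_n)
    (pi : 'rV[R]_n) (eps : R) : R :=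
  inf [set t : R | 0 <= t /\
    forall x : 'rV[R]_n, is_distribution x ->
      tv_dist (x *m transition L t) pi <= eps].

Definition inner_pi (R : realType) (n : nat) (pi u v : 'rV[R]_n) : R :=
  \sum_i u 0 i * v 0 i / pi 0 i.

Definition norm_pi (R : realType) (n : nat) (pi u : 'rV[R]_n) : R :=
  Num.sqrt (inner_pi pi u u).

(* Only the times s >= 0 matter.  The Markov property is stated in
   multiplied-out form: for every event of the form "v_r = k for all (r, k) in
   h" concerning the past of s, conditionally on it and on v_s = i the
   probability of v_(s+t) = j is the (i, j) entry of exp(t L).  Paths are right
   continuous for the discrete topology on the states. *)
Record random_walk (R : realType) (n : nat) (L : 'M[R]_n) (phi : 'rV[R]_n)
    (d : measure_display) (Omega : measurableType d) (P : probability Omega R)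
    (v : R -> Omega -> 'I_n) : Prop := {
  rw_measurable : forall s i, 0 <= s -> measurable [set w | v s w = i];
  rw_right_continuous : forall w s, 0 <= s ->
    \forall u \near s^'+, v u w = v s w;
  rw_initial : forall i, P [set w | v 0 w = i] = (phi 0 i)%:E;
  rw_markov : forall (h : seq (R * 'I_n)) (s t : R) (i j : 'I_n),
    0 <= s -> 0 <= t -> (forall p, p \in h -> 0 <= p.1 <= s) ->
    P ([set w | forall p, p \in h -> v p.1 w = p.2] `&`
       [set w | v s w = i] `&` [set w | v (s + t) w = j]) =
    (P ([set w | forall p, p \in h -> v p.1 w = p.2] `&`
        [set w | v s w = i]) * (transition L t i j)%:E)%E }.

Definition weight (R : realType) (n : nat) (Omega : Type)
    (f : R -> 'I_n -> R) (v : R -> Omega -> 'I_n) (t : R) (w : Omega) : R :=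
  (\int[lebesgue_measure]_(s in `[0%R, t]) f s (v s w))%R.

(* Main.v *)
Require Import Defs.
From HB Require Import structures.
From mathcomp Require Import all_boot all_order all_algebra.
From mathcomp Require Import all_classical all_reals all_analysis.
From mathcomp Require Import measurable_realfun ring lra.
Import Order.TTheory GRing.Theory Num.Theory numFieldNormedType.Exports.

Set Implicit Arguments.
Unset Strict Implicit.
Unset Printing Implicit Defensive.

Local Open Scope classical_set_scope.
Local Open Scope ring_scope.

(** Let T' be a time at which the chain is eps-mixed, T <= T' < 2 T.  Since
    eps <= 1/8, the kernel K = exp(T' L) halves the L^2(pi)-norm of mean zero
    functions.  Cutting [0, N T'] into N blocks and applying Jensen's inequality
    to the average over s in [0, T'], the exponential moment of X / T' is bounded
    by that of the discrete sums of f_(s + k T') (v_(s + k T')), k < N, which is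
    a product of N factors (multiplication by exp(theta f)) o K.  Tracking
    separately the mean and the mean zero part of the successive functions shows
    that each factor contributes at most 1 + (theta + 5 theta^2) mu.  Markov's
    inequality with theta = delta/12 (resp. 1/12, - delta/12) concludes. *)

(** * Transition matrices *)

(** The chain need not be reversible, so there is no spectral gap to use and total variation mixing
    itself has to yield a contraction: distance 1/8 puts the rows of [K] within 1/4 of pi in L^1,
    which becomes a factor 1/4 on squared L^2(pi)-norms, hence 1/2 on norms. Inside a block the
    states may be strongly correlated, so the factors that are multiplied always lie one time T'
    apart; the offset [s] of the sample times contributes one more kernel [transition L s], which
    does not increase the norm. Everything acts on functions, backwards from the last sample time,
    so f may change with time and phi enters once, at the end, through Cauchy-Schwarz: this is why
    the bound is linear in [norm_pi pi phi]. T' replaces T because T is an infimum: an element of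
    the set below 2 T is available without attainment, at the price of a factor 2 in the constant
    72. There is slack in the rate: theta = delta/12 gives 7 delta^2/144, of which only delta^2/36
    is kept. *)

Lemma mx_cvg (R : realType) m n (u : nat -> 'M[R]_(m, n)) (A : 'M[R]_(m, n)) :
  (forall i j, (fun k => u k i j) @ \oo --> A i j) -> u @ \oo --> A.
Proof.
move=> uA; apply/cvgrPdist_lt => e e0.
have : \forall k \near \oo, forall i j, `|A i j - u k i j| < e.
  apply: filter_forall => i; apply: filter_forall => j.
  by move/cvgrPdist_lt : (uA i j); apply.
apply: filterS => k uk; rewrite /Num.Def.normr/= mx_normrE.
by apply: bigmax_lt => // -[i j] _; rewrite !mxE; exact: uk.
Qed.

Lemma series_mxE (R : realType) m n (u : nat -> 'M[R]_(m, n)) N i j :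
  series u N i j = series (fun k => u k i j) N.
Proof. by rewrite !seriesEnat/= summxE. Qed.

Lemma mulmx_ge0 (R : numDomainType) m n p (A : 'M[R]_(m, n)) (B : 'M[R]_(n, p)) :
  (forall i j, 0 <= A i j) -> (forall i j, 0 <= B i j) ->
  forall i j, 0 <= (A *m B) i j.
Proof. by move=> A0 B0 i j; rewrite mxE sumr_ge0// => k _; rewrite mulr_ge0. Qed.

Lemma exprmx_ge0 (R : numDomainType) n (A : 'M[R]_n) :
  (forall i j, 0 <= A i j) -> forall k i j, 0 <= (A ^+ k) i j.
Proof.
move=> A0; elim=> [|k IH] i j.
  by rewrite expr0 [1]/(1%:M) mxE; case: eqP.
by rewrite exprS; exact: mulmx_ge0.
Qed.

(** The sum of all absolute entries plays the part of a submultiplicative norm; with it the scalar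
    exponential series dominates the matrix one entry by entry. *)
Lemma normr_exprmx_le (R : numDomainType) n (A : 'M[R]_n) k i j :
  `|(A ^+ k) i j| <= (\sum_i \sum_j `|A i j|) ^+ k.
Proof.
elim: k i j => [|k IH] i j.
  by rewrite !expr0 [1]/(1%:M) mxE; case: eqP; rewrite ?normr1 ?normr0.
rewrite !exprS [_ * _]/(A *m _) mxE; apply: (le_trans (ler_norm_sum _ _ _)).
under eq_bigr do rewrite normrM.
apply: (@le_trans _ _ (\sum_l `|A i l| * (\sum_i \sum_j `|A i j|) ^+ k)).
  by apply: ler_sum => l _; rewrite ler_wpM2l.
rewrite -mulr_suml ler_wpM2r ?exprn_ge0//.
  by apply: sumr_ge0 => a _; apply: sumr_ge0.
rewrite [leRHS](bigD1 i)//= lerDl.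
by apply: sumr_ge0 => a _; apply: sumr_ge0.
Qed.

Lemma exprmxZ (R : comPzRingType) n (A : 'M[R]_n) a k :
  (a *: A) ^+ k = a ^+ k *: A ^+ k.
Proof.
have mulE (B C : 'M[R]_n) : B * C = B *m C by [].
elim: k => [|k IH]; first by rewrite !expr0 scale1r.
by rewrite !exprS IH !mulE -scalemxAl -scalemxAr scalerA.
Qed.

(** [transition] is a bare [limn], which says nothing until convergence is known: each entry is
    dominated by the series of exp (|t| b), and [mx_cvg] reassembles the matrix. *)
Lemma cvg_transition_entry (R : realType) n (L : 'M[R]_n) t i j :
  series (fun k => t ^+ k / k`!%:R * (L ^+ k) i j) @ \oo --> transition L t i j.
Proof.
set b : R := \sum_i \sum_j `|L i j|.
have b0 : 0 <= b by apply: sumr_ge0 => a _; apply: sumr_ge0.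
have cvg_entry a c : cvgn (series (fun k => t ^+ k / k`!%:R * (L ^+ k) a c)).
  apply: normed_cvg.
  apply: (@series_le_cvg _ _ (exp_coeff (`|t| * b))).
  - by move=> k; rewrite normr_ge0.
  - by move=> k; rewrite exp_coeff_ge0// mulr_ge0.
  - move=> k; rewrite /exp_coeff/= !normrM normfV normrX normr_nat exprMn mulrAC.
    by rewrite ler_wpM2r// ler_wpM2l// normr_exprmx_le.
  - exact: is_cvg_series_exp_coeff.
pose u := fun k : nat => (t ^+ k / k`!%:R) *: L ^+ k.
have uE a c : (fun k => series u k a c) =
    series (fun k => t ^+ k / k`!%:R * (L ^+ k) a c).
  apply/funext => k; rewrite series_mxE; congr (series _ k).
  by apply/funext => l; rewrite !mxE.
pose A := \matrix_(a, c) limn (series (fun k => t ^+ k / k`!%:R * (L ^+ k) a c)).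
have uA : series u @ \oo --> A.
  by apply: mx_cvg => a c; rewrite uE mxE; exact: cvg_entry.
by rewrite /transition (cvg_lim _ uA)// mxE; exact: cvg_entry.
Qed.

Lemma cvg_sumr (R : realType) (I : finType) (f : I -> nat -> R) (l : I -> R) :
  (forall i, f i @ \oo --> l i) ->
  \sum_i f i k @[k --> \oo] --> \sum_i l i.
Proof.
move=> fl; elim: (index_enum I) => [|i s IH].
  by under eq_fun do rewrite big_nil; rewrite big_nil; exact: cvg_cst.
by under eq_fun do rewrite big_cons; rewrite big_cons; exact: cvgD.
Qed.

(** For k > 0 the rows of [L ^+ k] sum to zero, so the identity term alone contributes and every
    nonempty partial sum already has the limiting value. *)
Lemma transition_row_sum (R : realType) n (L : 'M[R]_n) t i :
  is_generator L -> \sum_j transition L t i j = 1.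
Proof.
move=> [_ L0].
have LX k a : \sum_j (L ^+ k.+1) a j = 0.
  rewrite exprSr; under eq_bigr do rewrite [_ * _]/(_ *m _) mxE.
  rewrite exchange_big/=; apply: big1 => l _.
  by rewrite -mulr_sumr L0 mulr0.
have : \sum_j series (fun k => t ^+ k / k`!%:R * (L ^+ k) i j) N @[N --> \oo]
    --> \sum_j transition L t i j.
  apply: (@cvg_sumr R _ (fun j => series (fun k => t ^+ k / k`!%:R * (L ^+ k) i j))).
  by move=> j; exact: cvg_transition_entry.
move=> cl; apply: (cvg_unique _ cl) => //.
apply: cvg_near_cst; near=> N; rewrite /=.
under eq_bigr do rewrite seriesEnat/= big_mkord.
rewrite exchange_big/=.
have -> : N = N.-1.+1 by rewrite prednK//; near: N; exists 1%N.
rewrite big_ord_recl [X in _ + X]big1 => [|k _].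
  rewrite addr0; under eq_bigr do rewrite /= expr0 fact0 divr1 mul1r expr0 mxE.
  by rewrite (bigD1 i)//= eqxx big1 ?addr0// => j /negPf; rewrite eq_sym => ->.
by rewrite -mulr_sumr lift0 LX mulr0.
Unshelve. all: by end_near. Qed.

Lemma transition_stationary (R : realType) n (L : 'M[R]_n) (pi : 'rV[R]_n) t j :
  pi *m L = 0 -> \sum_i pi 0 i * transition L t i j = pi 0 j.
Proof.
move=> piL.
have piLX k c : \sum_i pi 0 i * (L ^+ k.+1) i c = 0.
  have : pi *m (L *m L ^+ k) = 0 by rewrite mulmxA piL mul0mx.
  by move/rowP/(_ c); rewrite mxE [in RHS]mxE exprS.
have : \sum_i pi 0 i * series (fun k => t ^+ k / k`!%:R * (L ^+ k) i j) N
    @[N --> \oo] --> \sum_i pi 0 i * transition L t i j.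
  apply: (@cvg_sumr R _ (fun i N =>
    pi 0 i * series (fun k => t ^+ k / k`!%:R * (L ^+ k) i j) N)
    (fun i => pi 0 i * transition L t i j)).
  move=> i; apply: cvgMl_tmp; exact: cvg_transition_entry.
move=> cl; apply: (cvg_unique _ cl) => //.
apply: cvg_near_cst; near=> N; rewrite /=.
under eq_bigr do rewrite seriesEnat/= big_mkord mulr_sumr.
rewrite exchange_big/=.
have -> : N = N.-1.+1 by rewrite prednK//; near: N; exists 1%N.
rewrite big_ord_recl [X in _ + X]big1 => [|k _].
  rewrite addr0; under eq_bigr do rewrite /= expr0 fact0 divr1 mul1r expr0 mxE.
  rewrite (bigD1 j)//= eqxx mulr1 big1 ?addr0// => i /negPf ->.
  by rewrite mulr0.
under eq_bigr do rewrite mulrCA; by rewrite -mulr_sumr lift0 piLX mulr0.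
Unshelve. all: by end_near. Qed.

(** Euler's limit with an explicit error O(1/N): exp (x - x^2) <= 1 + x is raised to the power N+1,
    then 1 - exp (- y) <= y is applied to y = b^2 / (N+1). *)
Lemma expR_sub_expr_le (R : realType) (b : R) N : 0 <= b ->
  expR b - (1 + b / N.+1%:R) ^+ N.+1 <= expR b * b ^+ 2 / N.+1%:R.
Proof.
move=> b0; set x := b / N.+1%:R.
have N0 : 0 < N.+1%:R :> R by rewrite ltr0n.
have x0 : 0 <= x by rewrite divr_ge0.
(* Here 1 / (1 + x) = 1 - x / (1 + x) <= exp (- x / (1 + x)), and (x - x^2) (1 + x) = x - x^3 <=
   x. *)
have le1 : expR (x - x ^+ 2) <= 1 + x.
  have h : x - x ^+ 2 <= x / (1 + x).
    rewrite ler_pdivlMr; last by lra.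
    have : 0 <= x ^+ 3 by rewrite exprn_ge0.
    rewrite !exprS expr0; lra.
  rewrite (le_trans (_ : _ <= expR (x / (1 + x))))// ?ler_expR//.
  have := expR_ge1Dx (- (x / (1 + x))); rewrite expRN.
  have -> : 1 - x / (1 + x) = (1 + x)^-1 by field; lra.
  by rewrite lef_pV2// posrE ?expR_gt0//; lra.
have le2 : expR (b - b ^+ 2 / N.+1%:R) <= (1 + x) ^+ N.+1.
  have -> : b - b ^+ 2 / N.+1%:R = N.+1%:R * (x - x ^+ 2) by rewrite /x; field; lra.
  by rewrite expRM_natl lerXn2r// nnegrE ?expR_ge0//; lra.
rewrite lerBlDr -lerBlDl (le_trans _ le2)//.
rewrite expRD -mulrA -[X in X - _]mulr1 -mulrBr ler_wpM2l ?expR_ge0//.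
exact: expR_ge1Dx.
Qed.

(* The Euler products (1 + t L / N)^N are nonnegative for large N, and their
   distance to the partial sums of exp(t L) is dominated by the same distance
   for the scalar b = t * sum |L i j|. *)
Lemma transition_ge0 (R : realType) n (L : 'M[R]_n) t i j :
  is_generator L -> 0 <= t -> 0 <= transition L t i j.
Proof.
move=> [Loff _] t0.
set b : R := t * \sum_i \sum_j `|L i j|.
have sum0 : 0 <= \sum_i \sum_j `|L i j|.
  by apply: sumr_ge0 => a _; apply: sumr_ge0.
have b0 : 0 <= b by rewrite mulr_ge0.
have Lb a c : t * `|L a c| <= b.
  rewrite ler_wpM2l// (bigD1 a)//= (bigD1 c)//= -addrA lerDl addr_ge0 ?sumr_ge0//.
  by move=> d _; rewrite sumr_ge0.
pose S := series (fun k => t ^+ k / k`!%:R * (L ^+ k) i j).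
have SE : S @ \oo --> transition L t i j by exact: cvg_transition_entry.
(* The power N+1 expands into N+2 terms, hence the partial sum at [N.+2]; taking N large against b
   makes the diagonal of [E] nonnegative. *)
have lower : \forall N \near \oo,
    - (expR b * b ^+ 2) * harmonic N <= S N.+2.
  near=> N.
  have bN : b <= N.+1%:R.
    rewrite (@le_trans _ _ N%:R) ?ler_nat//; near: N; exact: nbhs_infty_ger.
  have N0 : 0 < N.+1%:R :> R by rewrite ltr0n.
  pose E : 'M[R]_n := 1%:M + (t / N.+1%:R) *: L.
  have E0 a c : 0 <= E a c.
    rewrite !mxE; have [->|ac] := eqVneq a c.
      have : `|t / N.+1%:R * L c c| <= 1.
        rewrite !normrM normfV (ger0_norm t0) (gtr0_norm N0) mulrAC.
        by rewrite ler_pdivrMr// mul1r (le_trans (Lb c c)).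
      rewrite ler_norml => /andP[+ _]; rewrite -subr_ge0 opprK mulr1n.
      by rewrite addrC.
    by rewrite mulr0n add0r mulr_ge0 ?divr_ge0// Loff.
  have EX : (E ^+ N.+1) i j = \sum_(k < N.+2)
      ('C(N.+1, k)%:R * (t / N.+1%:R) ^+ k) * (L ^+ k) i j.
    rewrite /E addrC exprD1n summxE; apply: eq_bigr => k _.
    by rewrite mulmxnE exprmxZ mxE -[LHS]mulr_natl mulrA.
  have SX : S N.+2 = \sum_(k < N.+2) (t ^+ k / k`!%:R) * (L ^+ k) i j.
    by rewrite /S seriesEnat/= big_mkord.
  have eX : (1 + b / N.+1%:R) ^+ N.+1 = \sum_(k < N.+2)
      ('C(N.+1, k)%:R * (t / N.+1%:R) ^+ k) * (\sum_i \sum_j `|L i j|) ^+ k.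
    rewrite addrC exprD1n; apply: eq_bigr => k _.
    by rewrite -mulr_natl -[in RHS]mulrA -exprMn /b [in RHS]mulrAC.
  have sX : \sum_(k < N.+2) (t ^+ k / k`!%:R) * (\sum_i \sum_j `|L i j|) ^+ k
      <= expR b.
    have -> : \sum_(k < N.+2) (t ^+ k / k`!%:R) * (\sum_i \sum_j `|L i j|) ^+ k =
        series (exp_coeff b) N.+2.
      rewrite seriesEnat/= big_mkord; apply: eq_bigr => k _.
      by rewrite /exp_coeff/= exprMn mulrAC.
    apply: nondecreasing_cvgn_le; last exact: is_cvg_series_exp_coeff.
    apply/nondecreasing_seqP => k; rewrite seriesSr lerDl.
    exact: exp_coeff_ge0.
  (* A falling factorial is at most a power, so no coefficient of the Euler product exceeds that of
     the exponential: the differences are nonnegative and can be compared with the scalar series. *)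
  have coef k : 'C(N.+1, k)%:R * (t / N.+1%:R) ^+ k <= t ^+ k / k`!%:R.
    rewrite exprMn mulrCA ler_wpM2l ?exprn_ge0//.
    rewrite exprVn ler_pdivrMr ?exprn_gt0// mulrC ler_pdivlMr ?ltr0n ?fact_gt0//.
    rewrite -natrX -natrM ler_nat bin_ffact.
    elim: k => [//|k IH]; rewrite ffactnSr expnSr leq_mul// leq_subLR leq_addl//.
  have diff : `|S N.+2 - (E ^+ N.+1) i j| <= expR b - (1 + b / N.+1%:R) ^+ N.+1.
    rewrite SX EX -sumrB (le_trans (ler_norm_sum _ _ _))//.
    apply: le_trans (lerB sX (lexx _)); rewrite eX -sumrB; apply: ler_sum => k _.
    rewrite -!mulrBl normrM ger0_norm ?subr_ge0//.
    by rewrite ler_wpM2l ?subr_ge0// normr_exprmx_le.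
  have E0' : 0 <= (E ^+ N.+1) i j by exact: exprmx_ge0.
  have := expR_sub_expr_le N b0.
  move: diff; rewrite ler_norml opprB => /andP[low _] up.
  rewrite mulNr /harmonic/= lerNl -[leRHS]opprK lerN2.
  move: low up E0'; move: ((E ^+ N.+1) i j) (S N.+2) ((1 + b / N.+1%:R) ^+ N.+1).
  move: (_ / _) => z w x u.
  by move=> *; lra.
have hl : - (expR b * b ^+ 2) * harmonic N @[N --> \oo] --> (0 : R).
  rewrite -[X in _ --> X](mulr0 (- (expR b * b ^+ 2))).
  by apply: cvgMl_tmp; exact: cvg_harmonic.
have SE2 : S N.+2 @[N --> \oo] --> transition L t i j.
  by have := SE; rewrite -(cvg_shiftn 2); under eq_fun do rewrite addn2.
exact: (ler_cvg_to hl SE2 lower).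
Unshelve. all: by end_near. Qed.

(** * Contraction in L^2(pi) *)

(** Meant for a power trick: a bound on all powers of a ratio, with a constant that may be huge,
    forces the ratio itself below 1. *)
Lemma expr_bounded_le1 (R : realType) (x C : R) :
  (forall k : nat, x ^+ k <= C) -> x <= 1.
Proof.
move=> xC; rewrite leNgt; apply/negP => x1.
have bernoulli k : 1 + k%:R * (x - 1) <= x ^+ k.
  elim: k => [|k IH]; first by rewrite mul0r addr0 expr0.
  rewrite exprS; have : 0 <= k%:R :> R by [].
  have : x * (1 + k%:R * (x - 1)) <= x * x ^+ k by rewrite ler_wpM2l//; lra.
  rewrite -natr1; have : 0 <= k%:R * (x - 1) ^+ 2 :> R.
    by rewrite mulr_ge0// sqr_ge0.
  by move=> *; lra.
have C0 : 0 <= C by rewrite (le_trans _ (xC 0%N)).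
have x10 : 0 < x - 1 by lra.
have := archi_boundP (divr_ge0 C0 (ltW x10)); rewrite ltr_pdivrMr// => Cb.
have := le_trans (bernoulli (Num.bound (C / (x - 1)))) (xC _); lra.
Qed.

Section weighted_l2.
Context {R : realType} {I : finType}.
Implicit Types (p g h : I -> R) (K : I -> I -> R).

Definition dotp p g h : R := \sum_i p i * g i * h i.
Definition nrm p g : R := Num.sqrt (dotp p g g).
Definition mean p g : R := \sum_i p i * g i.
Definition act K g : I -> R := fun i => \sum_j K i j * g j.

Lemma dotp_ge0 p g : (forall i, 0 <= p i) -> 0 <= dotp p g g.
Proof.
by move=> p0; apply: sumr_ge0 => i _; rewrite -mulrA mulr_ge0// -expr2 sqr_ge0.
Qed.

Lemma dotpC p g h : dotp p g h = dotp p h g.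
Proof. by apply: eq_bigr => i _; rewrite mulrAC. Qed.

(** Lagrange's identity: twice the gap is a weighted double sum of squares. The weights may vanish,
    so the rows of a kernel are admissible weights too. *)
Lemma dotp_CauchySchwarz p g h : (forall i, 0 <= p i) ->
  dotp p g h ^+ 2 <= dotp p g g * dotp p h h.
Proof.
move=> p0.
have : 0 <= \sum_i \sum_j p i * p j * (g i * h j - g j * h i) ^+ 2.
  by apply: sumr_ge0 => i _; apply: sumr_ge0 => j _; rewrite mulr_ge0 ?sqr_ge0 ?mulr_ge0.
have -> : \sum_i \sum_j p i * p j * (g i * h j - g j * h i) ^+ 2 =
    (dotp p g g * dotp p h h - dotp p g h ^+ 2) *+ 2.
  have E1 : dotp p g g * dotp p h h =
      \sum_i \sum_j p i * g i * g i * (p j * h j * h j) by rewrite big_distrlr.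
  have E2 : dotp p g g * dotp p h h =
      \sum_i \sum_j p i * h i * h i * (p j * g j * g j).
    by rewrite mulrC big_distrlr.
  have E3 : dotp p g h ^+ 2 =
      \sum_i \sum_j p i * g i * h i * (p j * g j * h j).
    by rewrite expr2 big_distrlr.
  have -> (x y : R) : (x - y) *+ 2 = x + x - y - y by ring.
  rewrite {1}E1 E2 E3 -!sumrN -!big_split/=.
  apply: eq_bigr => i _; rewrite -!sumrN -!big_split/=.
  by apply: eq_bigr => j _; ring.
rewrite pmulrn_lge0// subr_ge0; exact.
Qed.

Lemma mean_itv01 p g : (forall i, 0 <= p i) -> \sum_i p i = 1 ->
  (forall i, 0 <= g i <= 1) -> 0 <= mean p g <= 1.
Proof.
move=> p0 p1 g01; rewrite sumr_ge0 => [/=|i _]; last first.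
  by rewrite mulr_ge0//; case/andP: (g01 i).
by rewrite -[leRHS]p1 ler_sum// => i _; rewrite ler_piMr//; case/andP: (g01 i).
Qed.

Lemma nrm_ge0 p g : 0 <= nrm p g. Proof. exact: sqrtr_ge0. Qed.

Lemma sqr_nrm p g : (forall i, 0 <= p i) -> nrm p g ^+ 2 = dotp p g g.
Proof. by move=> p0; rewrite sqr_sqrtr// dotp_ge0. Qed.

Lemma dotp_le_nrm p g h : (forall i, 0 <= p i) ->
  `|dotp p g h| <= nrm p g * nrm p h.
Proof.
move=> p0; rewrite -ler_sqr ?nnegrE ?mulr_ge0 ?nrm_ge0// exprMn !sqr_nrm//.
by rewrite real_normK ?num_real// dotp_CauchySchwarz.
Qed.

Lemma nrmD p g h : (forall i, 0 <= p i) ->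
  nrm p (fun i => g i + h i) <= nrm p g + nrm p h.
Proof.
move=> p0; rewrite -ler_sqr ?nnegrE ?addr_ge0 ?nrm_ge0// sqrrD !sqr_nrm//.
have -> : dotp p (fun i => g i + h i) (fun i => g i + h i) =
    dotp p g g + dotp p g h *+ 2 + dotp p h h.
  rewrite mulr2n -!big_split/=; apply: eq_bigr => i _; ring.
rewrite lerD2r lerD2l lerMn2r/= (le_trans (ler_norm _))// dotp_le_nrm//.
Qed.

Lemma le_nrm p g h : (forall i, 0 <= p i) ->
  (forall i, `|g i| <= `|h i|) -> nrm p g <= nrm p h.
Proof.
move=> p0 gh; rewrite ler_wsqrtr//; apply: ler_sum => i _.
rewrite -!mulrA ler_wpM2l// -!expr2 -[g i ^+ 2]real_normK ?num_real//.
by rewrite -[h i ^+ 2]real_normK ?num_real// lerXn2r// nnegrE.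
Qed.

Lemma nrmZ p a g : nrm p (fun i => a * g i) = `|a| * nrm p g.
Proof.
rewrite /nrm -sqrtr_sqr -sqrtrM ?sqr_ge0//; congr Num.sqrt.
by rewrite mulr_sumr; apply: eq_bigr => i _; ring.
Qed.

Lemma eq_nrm p g h : g =1 h -> nrm p g = nrm p h.
Proof. by move=> gh; congr (nrm p _); exact/funext. Qed.

Lemma nrm_centered_le p g : (forall i, 0 <= p i) -> \sum_i p i = 1 ->
  nrm p (fun i => g i - mean p g) <= nrm p g.
Proof.
move=> p0 p1; rewrite ler_wsqrtr//.
have -> : dotp p (fun i => g i - mean p g) (fun i => g i - mean p g) =
    dotp p g g - mean p g ^+ 2.
  transitivity (dotp p g g + (\sum_i p i * g i) * (- mean p g *+ 2)
      + (\sum_i p i) * mean p g ^+ 2).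
    rewrite !mulr_suml -!big_split/=.
    by apply: eq_bigr => i _; ring.
  by rewrite p1 -/(mean p g); ring.
by rewrite lerBlDr lerDl sqr_ge0.
Qed.

Lemma nrm_le_mean p g : (forall i, 0 <= p i) -> \sum_i p i = 1 ->
  nrm p g <= `|mean p g| + nrm p (fun i => g i - mean p g).
Proof.
move=> p0 p1; have -> : `|mean p g| = nrm p (fun=> mean p g).
  rewrite /nrm /dotp -!mulr_suml p1 mul1r -expr2.
  by rewrite sqrtr_sqr.
rewrite (le_trans _ (nrmD _ _ p0))// le_eqVlt; apply/orP; left; apply/eqP.
by apply: eq_nrm => i; rewrite addrC subrK.
Qed.

End weighted_l2.

Section stochastic_kernel.
Context {R : realType} {I : finType}.
Variables (p : I -> R) (K : I -> I -> R).
Hypothesis p_gt0 : forall i, 0 < p i.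
Hypothesis p_sum : \sum_i p i = 1.
Hypothesis K_ge0 : forall i j, 0 <= K i j.
Hypothesis K_sum : forall i, \sum_j K i j = 1.
Hypothesis K_stat : forall j, \sum_i p i * K i j = p j.
Implicit Types g h : I -> R.

Let p_ge0 i : 0 <= p i. Proof. exact: ltW. Qed.

Lemma mean_act g : mean p (act K g) = mean p g.
Proof.
rewrite /mean; under eq_bigr do rewrite /act mulr_sumr.
rewrite exchange_big/=; apply: eq_bigr => j _.
by under eq_bigr do rewrite mulrA; rewrite -mulr_suml K_stat.
Qed.

Lemma act_subr g c i : act K (fun i => g i - c) i = act K g i - c.
Proof.
rewrite /act; under eq_bigr do rewrite mulrBr.
by rewrite sumrB -mulr_suml K_sum mul1r.
Qed.

(** Cauchy-Schwarz against 1 in the row [K i] gives (K g)^2 <= K (g^2) pointwise; stationarity then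
    integrates the right-hand side. *)
Lemma nrm_act_le g : nrm p (act K g) <= nrm p g.
Proof.
rewrite ler_wsqrtr//.
have -> : dotp p g g = mean p (act K (fun i => g i * g i)).
  by rewrite mean_act; apply: eq_bigr => i _; rewrite mulrA.
apply: ler_sum => i _; rewrite -mulrA ler_wpM2l// -expr2.
have := dotp_CauchySchwarz g (fun=> 1) (K_ge0 i); rewrite /dotp.
under eq_bigr do rewrite mulr1.
under [X in _ <= _ * X -> _]eq_bigr do rewrite !mulr1.
rewrite K_sum mulr1 => /le_trans; apply; apply: ler_sum => j _.
by rewrite mulrA.
Qed.

Lemma act_ge0 g : (forall i, 0 <= g i) -> forall i, 0 <= act K g i.
Proof. by move=> g0 i; apply: sumr_ge0 => j _; rewrite mulr_ge0. Qed.

Section mixing.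
(* The row mixing hypothesis bounds the time reversal in L^1(p) on mean zero
   functions.  The reversible kernel S = (time reversal) o K then contracts
   L^1(p), and, as |S^k g|_2 is log-convex in k, contracts L^2(p) at the same
   rate, without any spectral theorem. *)
Variable r : R.
Hypothesis r_gt0 : 0 < r.
Hypothesis K_mix : forall i, \sum_j `|K i j - p j| <= r.

Let rev i j := p j * K j i / p i.
Let n1 g := \sum_i p i * `|g i|.
Let S g := act rev (act K g).

Let p_rev g i : p i * act rev g i = \sum_j p j * g j * K j i.
Proof.
rewrite /act mulr_sumr; apply: eq_bigr => j _; rewrite /rev.
by field; rewrite gt_eqF.
Qed.

Let dotp_rev g h : dotp p (act rev g) h = dotp p g (act K h).
Proof.
rewrite /dotp; under eq_bigr do rewrite p_rev mulr_suml.
rewrite exchange_big/=; apply: eq_bigr => j _.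
by rewrite /act mulr_sumr; apply: eq_bigr => i _; rewrite !mulrA.
Qed.

Let mean_rev g : mean p (act rev g) = mean p g.
Proof.
rewrite /mean; under eq_bigr do rewrite p_rev.
rewrite exchange_big/=; apply: eq_bigr => j _.
by rewrite -mulr_sumr K_sum mulr1.
Qed.

Let n1_act g : n1 (act K g) <= n1 g.
Proof.
rewrite /n1 -/(mean p (fun i => `|g i|)) -(mean_act (fun i => `|g i|)).
apply: ler_sum => i _; rewrite ler_wpM2l//.
apply: (le_trans (ler_norm_sum _ _ _)); apply: ler_sum => j _.
by rewrite normrM ger0_norm.
Qed.

(** Summing over i with j fixed turns [rev] into the row j of K, where the mixing hypothesis lives;
    the zero mean of g allows [p i] to be subtracted from [K j i] for free. *)
Let n1_rev g : mean p g = 0 -> n1 (act rev g) <= r * n1 g.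
Proof.
move=> g0.
have E i : p i * `|act rev g i| = `|\sum_j p j * g j * (K j i - p i)|.
  rewrite -[X in X * _](ger0_norm (p_ge0 i)) -normrM p_rev; congr `|_|.
  under [RHS]eq_bigr do rewrite mulrBr.
  by rewrite sumrB -mulr_suml -/(mean p g) g0 mul0r subr0.
rewrite /n1; under eq_bigr do rewrite E.
apply: (@le_trans _ _ (\sum_i \sum_j p j * `|g j| * `|K j i - p i|)).
  apply: ler_sum => i _; apply: (le_trans (ler_norm_sum _ _ _)).
  by apply: ler_sum => j _; rewrite !normrM (ger0_norm (p_ge0 j)).
rewrite exchange_big/= mulr_sumr; apply: ler_sum => j _.
by rewrite -mulr_sumr mulrC ler_wpM2r// mulr_ge0.
Qed.

Let S_sym g h : dotp p (S g) h = dotp p g (S h).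
Proof. by rewrite /S dotp_rev dotpC [RHS]dotpC dotp_rev dotpC dotpC dotpC. Qed.

Let mean_S g : mean p (S g) = mean p g.
Proof. by rewrite /S mean_rev mean_act. Qed.

Let n1_iter g k : mean p g = 0 -> n1 (iter k S g) <= r ^+ k * n1 g.
Proof.
move=> g0; have mk m : mean p (iter m S g) = 0.
  by elim: m => // m IH; rewrite iterS mean_S.
elim: k => [|k IH]; first by rewrite expr0 mul1r.
rewrite iterS; apply: (le_trans (n1_rev _)); first by rewrite mean_act mk.
rewrite exprS -mulrA ler_wpM2l ?(ltW r_gt0)//.
exact: le_trans (n1_act _) _.
Qed.

(** A crude comparison of norms on a finite set. Its constant does not depend on the number of
    iterations of S, so the power trick removes it. *)
Let dotp_le_n1 g : dotp p g g <= (\sum_i (p i)^-1) * n1 g ^+ 2.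
Proof.
rewrite mulr_suml; apply: ler_sum => i _.
have -> : p i * g i * g i = (p i)^-1 * (p i * `|g i|) ^+ 2.
  rewrite exprMn real_normK ?num_real//; field; rewrite gt_eqF//.
rewrite ler_wpM2l ?invr_ge0// lerXn2r// ?nnegrE ?mulr_ge0//.
  by apply: sumr_ge0 => j _; rewrite mulr_ge0.
by rewrite /n1 (bigD1 i)//= lerDl sumr_ge0// => j _; rewrite mulr_ge0.
Qed.

Lemma nrm_act_mix g : mean p g = 0 -> nrm p (act K g) ^+ 2 <= r * nrm p g ^+ 2.
Proof.
move=> g0; rewrite !sqr_nrm//.
have r0 := ltW r_gt0.
pose b k := dotp p (iter k S g) (iter k S g).
have b_ge0 k : 0 <= b k by exact: dotp_ge0.
have b_cvx k : b k.+1 ^+ 2 <= b k * b k.+2.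
  have -> : b k.+1 = dotp p (iter k S g) (iter k.+2 S g).
    by rewrite /b 2!iterS S_sym.
  exact: dotp_CauchySchwarz.
(* Log-convexity makes the ratios b (k+1) / b k nondecreasing; they are multiplied out because some
   b k may vanish. *)
have b_ratio k : b 1%N * b k <= b k.+1 * b 0%N.
  elim: k => [|k IH]; first by [].
  have [bk0|bk] := eqVneq (b k) 0.
    have : b k.+1 ^+ 2 <= 0 by rewrite (le_trans (b_cvx k))// bk0 mul0r.
    move=> b1; have : b k.+1 ^+ 2 == 0 by rewrite eq_le b1 sqr_ge0.
    by rewrite sqrf_eq0 => /eqP ->; rewrite mulr0 mulr_ge0.
  have bk_gt0 : 0 < b k by rewrite lt_neqAle eq_sym bk b_ge0.
  rewrite -(ler_pM2r bk_gt0).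
  have h1 := ler_wpM2r (b_ge0 0%N) (b_cvx k).
  have h2 := ler_wpM2r (b_ge0 k.+1) IH.
  by move: h1 h2; rewrite expr2; lra.
have b_pow k : b 1%N ^+ k * b 0%N <= b k * b 0%N ^+ k.
  elim: k => [|k IH]; first by rewrite !expr0 mul1r mulr1.
  have h1 := ler_wpM2l (b_ge0 1%N) IH.
  have h2 := ler_wpM2r (exprn_ge0 k (b_ge0 0%N)) (b_ratio k).
  by rewrite !exprS; move: h1 h2; lra.
have b_n1 k : b k <= (\sum_i (p i)^-1) * n1 g ^+ 2 * (r ^+ 2) ^+ k.
  apply: (le_trans (dotp_le_n1 _)); rewrite -mulrA ler_wpM2l//.
    by apply: sumr_ge0 => j _; rewrite invr_ge0.
  rewrite -exprM mulnC exprM -exprMn mulrC lerXn2r// ?nnegrE ?n1_iter//.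
    by apply: sumr_ge0 => j _; rewrite mulr_ge0.
  rewrite mulr_ge0 ?exprn_ge0//.
  by apply: sumr_ge0 => j _; rewrite mulr_ge0.
set c := _ * _ in b_n1.
have b1_le : b 1%N <= r ^+ 2 * b 0%N.
  have [b00|b0] := eqVneq (b 0%N) 0.
    have := b_ratio 0%N.
    have : b 1%N ^+ 2 <= 0 by rewrite (le_trans (b_cvx 0%N))// b00 mul0r.
    move=> b1 _; have : b 1%N ^+ 2 == 0 by rewrite eq_le b1 sqr_ge0.
    by rewrite sqrf_eq0 => /eqP ->; rewrite b00 mulr0.
  have b0_gt0 : 0 < b 0%N by rewrite lt_neqAle eq_sym b0 b_ge0.
  have r2_gt0 : 0 < r ^+ 2 by rewrite exprn_gt0.
  rewrite -ler_pdivrMr// -[leRHS]mul1r -ler_pdivrMr//.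
  (* By [b_pow] and [b_n1], all powers of b 1 / (r^2 b 0) are at most c / b 0. *)
  apply: (@expr_bounded_le1 _ _ (c / b 0%N)) => k.
  rewrite !exprMn !exprVn ler_pdivrMr ?exprn_gt0// ler_pdivrMr ?exprn_gt0//.
  rewrite -[leRHS]mulrA mulrAC ler_pdivlMr// (le_trans (b_pow k))//.
  by rewrite mulrA ler_wpM2r ?exprn_ge0.
(* The reversal is the adjoint of K, so |K g|^4 = <S g, g>^2 <= b 1 b 0 <= (r b 0)^2. *)
rewrite -(ler_pXn2r (n := 2)) ?nnegrE ?mulr_ge0 ?dotp_ge0//.
rewrite -dotp_rev (le_trans (dotp_CauchySchwarz _ _ p_ge0))// exprMn.
by rewrite -/(b 0%N) -[X in X * _]/(b 1%N) expr2 mulrA ler_wpM2r.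
Qed.
End mixing.
End stochastic_kernel.

(** * One step of the exponential moment *)

(** Both sides are multiplied by 1 - x: on the left (1 - x) exp x <= 1, on the right 1 + x^2 (1 - 2
    x) >= 1. *)
Lemma expR_le_quadratic (R : realType) (x : R) : `|x| <= 2^-1 ->
  expR x <= 1 + x + 2 * x ^+ 2.
Proof.
rewrite ler_norml => /andP[x1 x2].
have := expR_ge1Dx (- x); rewrite expRN => h.
have e0 := expR_gt0 x.
have {}h : (1 - x) * expR x <= 1.
  by rewrite -ler_pdivlMr// div1r.
have : (1 - x) * expR x <= (1 - x) * (1 + x + 2 * x ^+ 2).
  rewrite (le_trans h)//; have : 0 <= x ^+ 2 * (1 - 2 * x).
    by rewrite mulr_ge0 ?sqr_ge0//; lra.
  by rewrite !exprS expr0; lra.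
by rewrite ler_pM2l//; lra.
Qed.

Section mgf_step.
Context {R : realType} {I : finType}.
Variables (p : I -> R) (K : I -> I -> R).
Hypothesis p_gt0 : forall i, 0 < p i.
Hypothesis p_sum : \sum_i p i = 1.
Hypothesis K_ge0 : forall i j, 0 <= K i j.
Hypothesis K_sum : forall i, \sum_j K i j = 1.
Hypothesis K_stat : forall j, \sum_i p i * K i j = p j.
Hypothesis K_mix : forall i, \sum_j `|K i j - p j| <= 4^-1.
Variables (theta mu : R).
Hypothesis theta_small : `|theta| <= 12^-1.

Let p_ge0 i : 0 <= p i. Proof. exact: ltW. Qed.

Let q := `|theta| + 2 * theta ^+ 2.

(** Of the coefficient 5, 2 comes from the second order term of exp, and 3 covers 2 q^2, the
    feedback of the mean zero part on the mean: |theta| <= 1/12 gives q <= 7/6 |theta|, so 2 q^2 <=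
    3 theta^2. *)
Definition growth : R := 1 + (theta + 5 * theta ^+ 2) * mu.

Let q_ge0 : 0 <= q. Proof. by rewrite addr_ge0// mulr_ge0// sqr_ge0. Qed.

Let q_le : q <= 7 / 72.
Proof.
rewrite /q -[theta ^+ 2]real_normK ?num_real//.
have : 0 <= `|theta| * (12^-1 - `|theta|) by rewrite mulr_ge0// subr_ge0.
by rewrite expr2; move: theta_small; lra.
Qed.

Let q2_le : theta + 2 * theta ^+ 2 + 2 * q ^+ 2 <= theta + 5 * theta ^+ 2.
Proof.
rewrite -addrA lerD2l /q -![theta ^+ 2]real_normK ?num_real//.
move: theta_small (normr_ge0 theta); set x := `|theta| => x1 x0.
have -> : x + 2 * x ^+ 2 = x * (1 + 2 * x) by ring.
have : (1 + 2 * x) ^+ 2 <= (7 / 6) ^+ 2.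
  by rewrite lerXn2r// ?nnegrE//; lra.
move=> /(ler_wpM2l (sqr_ge0 x)); rewrite -exprMn; have := sqr_ge0 x.
by rewrite [(7 / 6) ^+ 2]expr2; lra.
Qed.

Variable f : I -> R.
Hypothesis f01 : forall i, 0 <= f i <= 1.
Hypothesis f_mean : \sum_i p i * f i = mu.

Let e i := expR (theta * f i) - 1.

Let mu01 : 0 <= mu <= 1.
Proof.
by rewrite -f_mean; exact: mean_itv01.
Qed.

Let e_le i : e i <= (theta + 2 * theta ^+ 2) * f i.
Proof.
have /andP[f0 f1] := f01 i.
have : `|theta * f i| <= 2^-1.
  rewrite normrM (ger0_norm f0) (@le_trans _ _ `|theta|)//; last first.
    by move: theta_small; lra.
  by rewrite ler_piMr.
move=> /expR_le_quadratic h; rewrite /e lerBlDl (le_trans h)//.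
rewrite -addrA lerD2l [leRHS]mulrDl lerD2l -mulrA ler_pM2l// exprMn ler_wpM2l ?sqr_ge0//.
by rewrite expr2 ler_piMr.
Qed.

Let e_abs i : `|e i| <= q * f i.
Proof.
have /andP[f0 f1] := f01 i.
rewrite ler_norml; apply/andP; split.
  apply: (@le_trans _ _ (theta * f i)).
    rewrite -mulNr ler_wpM2r// /q opprD.
    rewrite (@le_trans _ _ (- `|theta|))// ?lerNnormlW//.
    by rewrite gerDl oppr_le0 mulr_ge0// sqr_ge0.
  by rewrite lerBrDl expR_ge1Dx.
by rewrite (le_trans (e_le i))// ler_wpM2r// lerD2r ler_norm.
Qed.

(** As 0 <= f <= 1, f^2 <= f and the second moment of f is at most mu: this is the origin of every
    factor sqrt mu below. *)
Let nrm_e : nrm p e <= q * Num.sqrt mu.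
Proof.
have -> : q * Num.sqrt mu = Num.sqrt (q ^+ 2 * mu).
  by rewrite sqrtrM ?sqr_ge0// sqrtr_sqr ger0_norm.
rewrite ler_wsqrtr// -f_mean mulr_sumr; apply: ler_sum => i _.
have /andP[f0 f1] := f01 i.
rewrite -mulrA [leRHS]mulrCA ler_wpM2l// -expr2 -[e i ^+ 2]real_normK ?num_real//.
have : `|e i| ^+ 2 <= (q * f i) ^+ 2.
  by rewrite lerXn2r ?nnegrE ?mulr_ge0.
move=> /le_trans; apply; rewrite exprMn ler_wpM2l ?sqr_ge0//.
by rewrite expr2 ler_piMr.
Qed.

Lemma growth_ge : 11 / 12 <= growth.
Proof.
have /andP[mu0 mu1] := mu01.
have h : - (12^-1) <= theta + 5 * theta ^+ 2.
  have := sqr_ge0 theta; move: theta_small; rewrite ler_norml => /andP[]; lra.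
rewrite /growth; have [?|?] := lerP 0 (theta + 5 * theta ^+ 2).
  by rewrite (@le_trans _ _ 1)// ?lerDl ?mulr_ge0//; lra.
have : (theta + 5 * theta ^+ 2) * 1 <= (theta + 5 * theta ^+ 2) * mu.
  by rewrite ler_nM2l.
lra.
Qed.

(* Keeping the mean zero part below the mean by a factor of order sqrt mu is what
   makes the second order term of [growth] proportional to mu. *)
Lemma mgf_step (g : I -> R) (c : R) : 0 <= c -> (forall i, 0 <= g i) ->
  mean p g <= c ->
  nrm p (fun i => g i - mean p g) <= 4 * q * Num.sqrt mu * c ->
  let g' i := expR (theta * f i) * act K g i in
  [/\ forall i, 0 <= g' i, mean p g' <= c * growth &
    nrm p (fun i => g' i - mean p g') <= 4 * q * Num.sqrt mu * (c * growth)].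
Proof.
move=> c0 g0 gc gperp g'.
have /andP[mu0 mu1] := mu01.
set s := Num.sqrt mu in gperp *.
have s0 : 0 <= s by exact: sqrtr_ge0.
have ss : s * s = mu by rewrite -expr2 sqr_sqrtr.
pose m := mean p g.
have m0 : 0 <= m by apply: sumr_ge0 => i _; rewrite mulr_ge0.
(* Under K the mean [m] survives and the rest [h] is halved; multiplying by 1 + e gives the four
   terms of [g'E], among which [e * h] feeds the mean zero part back into the mean, at second order
   only. *)
pose h i := act K g i - m.
have h_mean : mean p h = 0.
  rewrite /mean /h; under eq_bigr do rewrite mulrBr.
  rewrite sumrB -mulr_suml p_sum mul1r -/(mean p _) mean_act//.
  by rewrite subrr.
have h_nrm : nrm p h <= 2 * q * s * c.
  have hE : h = act K (fun i => g i - m).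
    by apply/funext => i; rewrite act_subr.
  have cent : mean p (fun i => g i - m) = 0.
    rewrite /mean; under eq_bigr do rewrite mulrBr.
    by rewrite sumrB -mulr_suml p_sum mul1r subrr.
  have : nrm p h ^+ 2 <= (2^-1 * nrm p (fun i => g i - m)) ^+ 2.
    rewrite hE (le_trans (nrm_act_mix p_gt0 K_ge0 K_sum K_stat _ K_mix cent))//.
    by rewrite exprMn ler_wpM2r ?sqr_ge0// expr2; lra.
  rewrite ler_pXn2r// ?nnegrE ?mulr_ge0 ?nrm_ge0// => /le_trans; apply.
  rewrite mulrC ler_pdivrMr// (le_trans gperp)//.
  by rewrite le_eqVlt; apply/orP; left; apply/eqP; ring.
have g'E i : g' i = h i + m + e i * h i + m * e i.
  by rewrite /g' /e /h; ring.
have e_mean : mean p e <= (theta + 2 * theta ^+ 2) * mu.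
  rewrite -f_mean mulr_sumr; apply: ler_sum => i _.
  by rewrite mulrCA ler_wpM2l.
have eh : mean p (fun i => e i * h i) <= q * s * (2 * q * s * c).
  have -> : mean p (fun i => e i * h i) = dotp p e h.
    by apply: eq_bigr => i _; rewrite mulrA.
  rewrite (le_trans (ler_norm _))// (le_trans (dotp_le_nrm _ _ _))//.
  by rewrite ler_pM ?nrm_ge0.
have g'_mean : mean p g' = m + mean p (fun i => e i * h i) + m * mean p e.
  transitivity (mean p h + m * \sum_i p i
      + mean p (fun i => e i * h i) + m * mean p e).
    rewrite /mean !mulr_sumr -!big_split/=; apply: eq_bigr => i _.
    rewrite g'E; ring.
  by rewrite h_mean p_sum; ring.
have mean_le : mean p g' <= c * growth.
  have : m * (1 + (theta + 2 * theta ^+ 2) * mu) <=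
         c * (1 + (theta + 2 * theta ^+ 2) * mu).
    rewrite ler_wpM2r//.
    have : - (12^-1) <= theta + 2 * theta ^+ 2.
      have := sqr_ge0 theta; move: theta_small; rewrite ler_norml => /andP[]; lra.
    move=> /(ler_wpM2r mu0); lra.
  have := ler_wpM2l m0 e_mean.
  have := ler_wpM2r (mulr_ge0 c0 mu0) q2_le.
  move: eh; rewrite g'_mean /growth -ss expr2 => *; nra.
split=> //.
- by move=> i; rewrite mulr_ge0 ?expR_ge0//; exact: act_ge0.
(* Centering removes the constant m, so only [w] counts, and it does not increase the norm of
   [w]. *)
- pose w i := expR (theta * f i) * h i + m * e i.
  have g'w i : g' i = m + w i by rewrite g'E /w /e; ring.
  have -> : nrm p (fun i => g' i - mean p g') = nrm p (fun i => w i - mean p w).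
    apply: eq_nrm => i.
    have -> : mean p g' = m + mean p w.
      rewrite {1}/mean; under eq_bigr do rewrite g'w mulrDr.
      by rewrite big_split/= -mulr_suml p_sum mul1r.
    by rewrite g'w; ring.
  rewrite (le_trans (nrm_centered_le _ _ _))// (le_trans (nrmD _ _ _))//.
  have n1 : nrm p (fun i => expR (theta * f i) * h i) <= (1 + q) * nrm p h.
    have q1 : 0 <= 1 + q by rewrite addr_ge0.
    rewrite -[X in X * _](ger0_norm q1) -nrmZ; apply: le_nrm => // i.
    rewrite !normrM ler_wpM2r// (ger0_norm q1) ger0_norm ?expR_ge0//.
    have := e_abs i; rewrite ler_norml => /andP[_]; rewrite /e lerBlDl => /le_trans.
    apply.
    by rewrite lerD2l ler_piMr//; case/andP: (f01 i).
  have n2 : nrm p (fun i => m * e i) <= c * (q * s).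
    by rewrite nrmZ ger0_norm// ler_pM ?nrm_ge0.
  have n3 : (1 + q) * nrm p h <= (1 + q) * (2 * q * s * c).
    by rewrite ler_wpM2l// addr_ge0.
  rewrite (le_trans (lerD n1 n2))// (le_trans (lerD n3 (lexx _)))//.
  have -> : (1 + q) * (2 * q * s * c) + c * (q * s) = (q * s * c) * (3 + 2 * q).
    by ring.
  have -> : 4 * q * s * (c * growth) = (q * s * c) * (4 * growth) by ring.
  (* After the halving the constant 4 has become 2 (1 + q) + 1 = 3 + 2 q; q <= 7/72 and growth >=
     11/12 bring it below 4 growth, so the invariant reproduces itself. *)
  rewrite ler_wpM2l ?mulr_ge0//; move: growth_ge q_le; lra.
Qed.

End mgf_step.

(** * Iterated exponential moments *)

(** If pi vanishes at b, the balance equation at b is a sum of nonnegative terms equal to 0, so pi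
    vanishes at every a with a positive rate to b; irreducibility spreads the zero to all states. *)
Lemma stationary_gt0 (R : realType) n (L : 'M[R]_n) (pi : 'rV[R]_n) :
  is_generator L -> ergodic L -> is_stationary L pi -> forall i, 0 < pi 0 i.
Proof.
move=> [Loff _] erg [[pi0 pi1] piL] i; rewrite lt_neqAle pi0 andbT eq_sym.
apply/negP => /eqP pii0.
have back a b : pi 0 b = 0 -> (a != b) && (0 < L a b) -> pi 0 a = 0.
  move=> pib0 /andP[ab Lab].
  have /rowP/(_ b) := piL; rewrite !mxE => /eqP.
  rewrite psumr_eq0 => [/allP/(_ a)|c _]; last first.
    have [->|cb] := eqVneq c b; first by rewrite pib0 mul0r.
    by rewrite mulr_ge0// Loff.
  by rewrite mem_index_enum => /(_ isT)/=; rewrite mulf_eq0 (gt_eqF Lab) orbF => /eqP.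
have all0 j : pi 0 j = 0.
  have /connectP[s ps iE] := erg j i.
  elim: s j ps iE => [|k s IH] j /=; first by move=> _ <-.
  by move=> /andP[jk ps] iE; apply: (back _ k) => //; exact: IH.
by move: pi1; rewrite big1// => /eqP; rewrite eq_sym oner_eq0.
Qed.

(** The set where w <= u and its complement each carry one half of the L^1 distance. *)
Lemma sum_norm_le_tv (R : realType) n (u w : 'rV[R]_n) :
  \sum_i `|u 0 i - w 0 i| <= 2 * tv_dist u w.
Proof.
have tvP (A : {set 'I_n}) :
    `|\sum_(i in A) u 0 i - \sum_(i in A) w 0 i| <= tv_dist u w.
  exact: le_bigmax.
pose A := [set i | w 0 i <= u 0 i]%SET.
rewrite (bigID (mem A))/= mulr_natl mulr2n lerD//.
  apply: le_trans (tvP A); rewrite -sumrB ger0_norm; last first.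
    by apply: sumr_ge0 => i; rewrite inE subr_ge0.
  by apply: ler_sum => i; rewrite inE => ?; rewrite ger0_norm// subr_ge0.
apply: le_trans (tvP (~: A)%SET); rewrite -sumrB -normrN -sumrN.
rewrite (eq_bigl (mem (~: A)%SET)) => [|i]; last by rewrite !inE.
rewrite ger0_norm; last first.
  by apply: sumr_ge0 => i; rewrite !inE -ltNge opprB subr_ge0 => /ltW.
apply: ler_sum => i; rewrite !inE -ltNge => /ltW iA.
by rewrite -normrN ger0_norm// opprB subr_ge0.
Qed.

Lemma mixing_rows (R : realType) n (K : 'M[R]_n) (pi : 'rV[R]_n) (eps : R) :
  (forall x, is_distribution x -> tv_dist (x *m K) pi <= eps) ->
  forall i, \sum_j `|K i j - pi 0 j| <= 2 * eps.
Proof.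
move=> mix i.
have di : is_distribution (delta_mx 0 i : 'rV[R]_n).
  split=> [j|]; first by rewrite mxE ler0n.
  rewrite (bigD1 i)//= mxE !eqxx big1 ?addr0// => j /negPf ji.
  by rewrite mxE ji andbF.
have := sum_norm_le_tv (delta_mx 0 i *m K) pi; rewrite -rowE.
under eq_bigr do rewrite mxE.
by move=> /le_trans; apply; rewrite ler_wpM2l// rowE mix.
Qed.

(** The norm of the measure phi with weights 1/pi is the L^2(pi)-norm of its density phi/pi, so this
    is Cauchy-Schwarz for the density. *)
Lemma dot_le_norm_pi (R : realType) n (pi phi : 'rV[R]_n) (g : 'I_n -> R) :
  (forall i, 0 < pi 0 i) ->
  \sum_i phi 0 i * g i <= norm_pi pi phi * nrm (pi 0) g.
Proof.
move=> pi0; have pi_ge0 i : 0 <= pi 0 i by exact: ltW.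
have -> : \sum_i phi 0 i * g i = dotp (pi 0) (fun i => phi 0 i / pi 0 i) g.
  apply: eq_bigr => i _; congr (_ * _); rewrite mulrCA divff ?mulr1//.
  by rewrite gt_eqF.
have -> : norm_pi pi phi = nrm (pi 0) (fun i => phi 0 i / pi 0 i).
  congr Num.sqrt; apply: eq_bigr => i _.
  by field; rewrite gt_eqF.
by rewrite (le_trans (ler_norm _))// dotp_le_nrm.
Qed.

(** Makes the claimed bounds at least 1, hence trivial, whenever the exponent does not exceed 1. *)
Lemma norm_pi_ge1 (R : realType) n (pi phi : 'rV[R]_n) :
  (forall i, 0 < pi 0 i) -> \sum_i pi 0 i = 1 -> is_distribution phi ->
  1 <= norm_pi pi phi.
Proof.
move=> pi0 pi1 [_ phi1].
have := dot_le_norm_pi phi (fun=> 1) pi0.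
under eq_bigr do rewrite mulr1; rewrite phi1.
have -> : nrm (pi 0) (fun=> 1) = 1.
  by rewrite /nrm /dotp; under eq_bigr do rewrite !mulr1; rewrite pi1 sqrtr1.
by rewrite mulr1.
Qed.

(* [mgf_along L f theta u l i] is the expectation of
   exp (theta * (f (u + a1) v_(u + a1) + f (u + a1 + a2) v_(u + a1 + a2) + ...))
   for the walk started from i at time u, where l = [:: a1, a2, ...]. *)
Fixpoint mgf_along (R : realType) n (L : 'M[R]_n) (f : R -> 'I_n -> R)
    (theta u : R) (l : seq R) : 'I_n -> R :=
  if l is a :: l' then
    act (transition L a)
      (fun j => expR (theta * f (u + a) j) * mgf_along L f theta (u + a) l' j)
  else fun=> 1.

Section mgf_bound.
Context {R : realType} {n : nat}.
Variables (L : 'M[R]_n) (pi : 'rV[R]_n) (T : R) (f : R -> 'I_n -> R) (mu theta : R).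
Hypothesis L_gen : is_generator L.
Hypothesis pi_gt0 : forall i, 0 < pi 0 i.
Hypothesis pi_sum : \sum_i pi 0 i = 1.
Hypothesis pi_stat : pi *m L = 0.
Hypothesis T_ge0 : 0 <= T.
Hypothesis T_mix : forall i, \sum_j `|transition L T i j - pi 0 j| <= 4^-1.
Hypothesis theta_small : `|theta| <= 12^-1.
Hypothesis f01 : forall s i, 0 <= s -> 0 <= f s i <= 1.
Hypothesis f_mean : forall s, 0 <= s -> \sum_i pi 0 i * f s i = mu.

Let h u N i := expR (theta * f u i) * mgf_along L f theta u (nseq N T) i.

(** N gaps separate N+1 sample times, hence the exponent N+1. The induction runs backwards from the
    constant 1, which has mean 1 and no mean zero part; as K fixes it, the base case is a step too.
    The time u is general because f depends on it. *)
Let h_bound u N : 0 <= u -> [/\ forall i, 0 <= h u N i,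
  mean (pi 0) (h u N) <= growth theta mu ^+ N.+1 &
  nrm (pi 0) (fun i => h u N i - mean (pi 0) (h u N)) <=
  4 * (`|theta| + 2 * theta ^+ 2) * Num.sqrt mu * growth theta mu ^+ N.+1].
Proof.
have G0 : 0 <= growth theta mu.
  have := growth_ge pi_gt0 pi_sum theta_small (fun i => f01 i (lexx 0)) (f_mean (lexx 0)).
  by apply: le_trans.
pose K := transition L T.
have step v g c : 0 <= v -> 0 <= c -> (forall i, 0 <= g i) ->
  mean (pi 0) g <= c -> _ -> _ :=
  fun v0 => @mgf_step R 'I_n (pi 0) K pi_gt0 pi_sum
    (fun i j => transition_ge0 i j L_gen T_ge0)
    (fun i => transition_row_sum T i L_gen)
    (fun j => transition_stationary T j pi_stat) T_mix theta mu theta_small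
    (f v) (fun i => f01 i v0) (f_mean v0) g c.
have hS v M : h v M.+1 = fun i => expR (theta * f v i) * act K (h (v + T) M) i by [].
elim: N u => [|N IH] u u0.
  have -> : h u 0%N = fun i => expR (theta * f u i) * act K (fun=> 1) i.
    apply/funext => i; rewrite /h/= /act; under eq_bigr do rewrite mulr1.
    by rewrite transition_row_sum.
  have m1 : mean (pi 0) (fun=> 1) = 1.
    by rewrite /mean; under eq_bigr do rewrite mulr1.
  rewrite -[growth theta mu ^+ 1]mul1r; apply: step => //.
    by rewrite m1.
  rewrite m1 (@eq_nrm _ _ _ _ (fun=> 0)); last by move=> i; rewrite subrr.
  rewrite /nrm /dotp big1 ?sqrtr0 => [|i _]; last by rewrite mulr0.
  by rewrite mulr1 mulr_ge0 ?sqrtr_ge0// mulr_ge0// addr_ge0// mulr_ge0// sqr_ge0.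
have [h0 h1 h2] := IH (u + T) (addr_ge0 u0 T_ge0).
by rewrite hS exprSr; apply: step => //; exact: exprn_ge0.
Qed.

(** The first gap s is arbitrary, so its kernel is only used as a contraction. The factor 2 adds the
    mean and the mean zero part, each at most growth^(N+1) since 4 q sqrt mu <= 1. *)
Lemma mgf_along_le (phi : 'rV[R]_n) s N : is_distribution phi -> 0 <= s ->
  \sum_i phi 0 i * mgf_along L f theta 0 (s :: nseq N T) i <=
  2 * norm_pi pi phi * expR (N.+1%:R * ((theta + 5 * theta ^+ 2) * mu)).
Proof.
move=> phi_dist s0.
have pi_ge0 i : 0 <= pi 0 i by exact: ltW.
have -> : mgf_along L f theta 0 (s :: nseq N T) = act (transition L s) (h s N).
  by rewrite /= add0r.
apply: (le_trans (dot_le_norm_pi _ _ pi_gt0)).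
rewrite [2 * _]mulrC -mulrA ler_wpM2l ?sqrtr_ge0//.
apply: le_trans.
  apply: nrm_act_le => //.
  - by move=> i j; exact: transition_ge0.
  - by move=> i; exact: transition_row_sum.
  - by move=> j; exact: transition_stationary.
have [h0 h1 h2] := h_bound N s0.
have mu01 : 0 <= mu <= 1.
  by rewrite -(f_mean (lexx 0)); apply: mean_itv01 => // i; exact: f01.
have G0 : 0 <= growth theta mu.
  have := growth_ge pi_gt0 pi_sum theta_small (fun i => f01 i (lexx 0)) (f_mean (lexx 0)).
  by apply: le_trans.
have GN : growth theta mu ^+ N.+1 <=
    expR (N.+1%:R * ((theta + 5 * theta ^+ 2) * mu)).
  by rewrite expRM_natl lerXn2r ?nnegrE ?expR_ge0// expR_ge1Dx.
have q1 : 4 * (`|theta| + 2 * theta ^+ 2) * Num.sqrt mu <= 1.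
  have s1 : Num.sqrt mu <= 1.
    by rewrite -[leRHS]sqrtr1 ler_wsqrtr//; case/andP: mu01.
  rewrite -[leRHS]mulr1 ler_pM ?sqrtr_ge0//.
    by rewrite mulr_ge0// addr_ge0// mulr_ge0// sqr_ge0.
  rewrite -[theta ^+ 2]real_normK ?num_real//.
  have : 0 <= `|theta| * (12^-1 - `|theta|) by rewrite mulr_ge0// subr_ge0.
  by rewrite expr2; move: theta_small; lra.
apply: (le_trans (nrm_le_mean _ pi_ge0 pi_sum)).
rewrite ger0_norm; last by apply: sumr_ge0 => i _; rewrite mulr_ge0.
rewrite mulr_natl mulr2n lerD// ?(le_trans h1)//.
rewrite (le_trans h2)// (le_trans _ GN)// -[leRHS]mul1r ler_wpM2r//.
exact: exprn_ge0.
Qed.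

End mgf_bound.

(** * Exponential moments of the walk through the Markov property *)

Fixpoint sum_along (R : realType) n (Omega : Type) (f : R -> 'I_n -> R)
    (v : R -> Omega -> 'I_n) (u : R) (l : seq R) (w : Omega) : R :=
  if l is a :: l' then f (u + a) (v (u + a) w) + sum_along f v (u + a) l' w
  else 0.

Section walk_mgf.
Context {R : realType} {n : nat} {d : measure_display} {Omega : measurableType d}.
Variables (L : 'M[R]_n) (phi : 'rV[R]_n) (P : probability Omega R).
Variables (v : R -> Omega -> 'I_n) (f : R -> 'I_n -> R) (theta : R).
Hypothesis walk : random_walk L phi P v.
Hypothesis L_gen : is_generator L.

Lemma measurable_walk_comp (g : 'I_n -> R) s : 0 <= s ->
  measurable_fun setT (fun w => g (v s w)).
Proof.
move=> s0; have -> : (fun w => g (v s w)) =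
    fun w => \sum_i g i * \1_[set w | v s w = i] w.
  apply/funext => w; rewrite (bigD1 (v s w))//= indicE mem_set//= mulr1.
  rewrite big1 ?addr0// => i /eqP iv; rewrite indicE memNset ?mulr0//=.
  by move=> /esym.
apply: measurable_sum => i; apply: measurable_funM => //.
exact/measurable_indic/(rw_measurable walk).
Qed.

Lemma measurable_sum_along u l : 0 <= u -> all (>= 0) l ->
  measurable_fun setT (sum_along f v u l).
Proof.
elim: l u => [|a l IH] u u0 /=; first by move=> _; exact: measurable_cst.
move=> /andP[a0 l0]; apply: measurable_funD.
  by apply: (measurable_walk_comp (f (u + a))); rewrite addr_ge0.
by apply: IH => //; rewrite addr_ge0.
Qed.

Let past (h : seq (R * 'I_n)) := [set w | forall p, p \in h -> v p.1 w = p.2].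

Let past_cons p h : past (p :: h) = past h `&` [set w | v p.1 w = p.2].
Proof.
apply/seteqP; split => [w hw|w [hw pw] r]; last first.
  by rewrite inE => /orP[/eqP ->//|]; exact: hw.
by split=> [r rh|]; apply: hw; rewrite inE ?eqxx ?rh ?orbT.
Qed.

Let measurable_past h : (forall p, p \in h -> 0 <= p.1) -> measurable (past h).
Proof.
elim: h => [_|p h IH h0].
  by rewrite (_ : past [::] = setT)//; apply/seteqP; split.
rewrite past_cons; apply: measurableI.
  by apply: IH => r rh; apply: h0; rewrite inE rh orbT.
by apply: (rw_measurable walk); apply: h0; rewrite inE eqxx.
Qed.

Let mgf_along_ge0 u l i : all (>= 0) l -> 0 <= mgf_along L f theta u l i.
Proof.
elim: l u i => [//|a l IH] u i /= /andP[a0 l0].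
apply: sumr_ge0 => j _; rewrite mulr_ge0 ?transition_ge0//.
by rewrite mulr_ge0 ?expR_ge0// IH.
Qed.

(** The history h is arbitrary because each use of the Markov property moves the present state into
    the past. Multiplying by the probability of the event avoids conditioning on null events. *)
Let integral_mgf_along h u i l : 0 <= u -> all (>= 0) l ->
  (forall p, p \in h -> 0 <= p.1 <= u) ->
  (\int[P]_(w in past h `&` [set w | v u w = i])
      (expR (theta * sum_along f v u l w))%:E =
   P (past h `&` [set w | v u w = i]) * (mgf_along L f theta u l i)%:E)%E.
Proof.
elim: l h u i => [|a l IH] h u i u0.
  move=> _ hu; set A := _ `&` _.
  have mA : measurable A.
    apply: measurableI; last exact: (rw_measurable walk).
    by apply: measurable_past => p /hu/andP[].
  under eq_integral do rewrite /= mulr0 expR0.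
  by rewrite integral_cst// mule1 mul1e.
rewrite [all _ _]/= => /andP[a0 l0] hu; set A := _ `&` _.
have ua0 : 0 <= u + a by rewrite addr_ge0.
have hA : A = past ((u, i) :: h) by rewrite past_cons.
have mA : measurable A.
  by rewrite hA; apply: measurable_past => p; rewrite inE => /orP[/eqP ->//|/hu/andP[]].
pose F j := A `&` [set w | v (u + a) w = j].
have mF j : measurable (F j) by apply: measurableI => //; exact: (rw_measurable walk).
have AE : A = \big[setU/set0]_(j <- index_enum 'I_n) F j.
  rewrite -bigcup_seq; apply/seteqP; split => [w Aw|w [j _ []//]].
  by exists (v (u + a) w) => //=; rewrite mem_index_enum.
have mS : measurable_fun setT (sum_along f v (u + a) l).
  exact: measurable_sum_along.
have mE : measurable_fun setT
    (fun w => (expR (theta * sum_along f v u (a :: l) w))%:E).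
  apply/measurable_EFinP; apply: measurableT_comp => //.
  by apply: measurable_funM => //; apply: measurable_sum_along => //=; rewrite a0.
rewrite [in LHS]AE ge0_integral_bigsetU//=; last 3 first.
  - exact: index_enum_uniq.
  - by move=> j k _ _ [w [[_ /= <-] [_ /= <-]]].
  - exact: measurable_funTS.
transitivity (\sum_j (P A * (transition L a i j *
    (expR (theta * f (u + a) j) * mgf_along L f theta (u + a) l j))%:E)%E).
  apply: eq_bigr => j _.
  transitivity (\int[P]_(w in F j) ((expR (theta * f (u + a) j))%:E *
      (expR (theta * sum_along f v (u + a) l w))%:E))%E.
    apply: eq_integral => w; rewrite inE => -[_ /= ->].
    by rewrite mulrDr expRD EFinM.
  rewrite ge0_integralZl//; last first.
    apply: measurable_funTS; apply/measurable_EFinP; apply: measurableT_comp => //.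
    exact: measurable_funM.
  (* The induction hypothesis is used at time u + a with (u, i) added to the history. *)
  rewrite /F hA IH//; last first.
    move=> p; rewrite inE => /orP[/eqP ->/=|/hu/andP[p0 pu]].
      by rewrite u0 lerDl.
    by rewrite p0 (le_trans pu)// lerDl.
  rewrite -hA /A (rw_markov walk)//.
  by rewrite !EFinM !muleA; congr (_ * _)%E; rewrite -muleA muleC.
rewrite -ge0_sume_distrr => [|j _]; first by rewrite sumEFin.
rewrite lee_fin mulr_ge0 ?transition_ge0// mulr_ge0 ?expR_ge0//.
exact: mgf_along_ge0.
Qed.

Lemma expectation_mgf_along l : all (>= 0) l ->
  (\int[P]_w (expR (theta * sum_along f v 0 l w))%:E =
   (\sum_i phi 0 i * mgf_along L f theta 0 l i)%:E)%E.
Proof.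
move=> l0.
pose F i := [set w | v 0 w = i].
have TE : setT = \big[setU/set0]_(i <- index_enum 'I_n) F i.
  rewrite -bigcup_seq; apply/seteqP; split => [w _|//].
  by exists (v 0 w) => //=; rewrite mem_index_enum.
rewrite TE ge0_integral_bigsetU//=; last 4 first.
  - by move=> i; exact: (rw_measurable walk).
  - exact: index_enum_uniq.
  - by move=> j k _ _ [w [/= <- /= <-]].
  - apply: measurable_funTS; apply/measurable_EFinP; apply: measurableT_comp => //.
    by apply: measurable_funM => //; exact: measurable_sum_along.
rewrite -sumEFin; apply: eq_bigr => i _.
have pT : past [::] = setT by apply/seteqP; split.
have := @integral_mgf_along [::] 0 i l (lexx 0) l0.
by rewrite pT setTI EFinM -(rw_initial walk) => ->.
Qed.

End walk_mgf.

(** * The weight of the walk *)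

(* By right continuity, v s = lim_m v (d_m s), where d_m s is the point of the
   grid of mesh 1/(m+1) that follows s. *)
Lemma measurable_walk_graph (R : realType) n (L : 'M[R]_n) (phi : 'rV[R]_n)
    (d : measure_display) (Omega : measurableType d) (P : probability Omega R)
    (v : R -> Omega -> 'I_n) i :
  random_walk L phi P v ->
  measurable [set z : R * Omega | 0 <= z.1 /\ v z.1 z.2 = i].
Proof.
move=> walk.
pose g m k : R := k%:R / m.+1%:R.
pose B m := \bigcup_k (`[g m k, g m k.+1[%classic `*` [set w | v (g m k.+1) w = i]).
have g0 m k : 0 <= g m k by rewrite divr_ge0.
(* [B m] is the event v (d_m s) = i. In a discrete state space convergence is eventual equality, so
   the graph is the lower limit of the [B m]. *)
have -> : [set z : R * Omega | 0 <= z.1 /\ v z.1 z.2 = i] =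
    \bigcup_M \bigcap_(m in [set m | (M <= m)%N]) B m.
  have BE m s w : 0 <= s -> exists u, [/\ s < u, u <= s + m.+1%:R^-1 &
      B m (s, w) <-> v u w = i].
    move=> s0; pose k := Num.truncn (s * m.+1%:R).
    have m0 : 0 < m.+1%:R :> R by rewrite ltr0n.
    have /andP[ks sk] : g m k <= s < g m k.+1.
      rewrite /g ler_pdivrMr// ltr_pdivlMr//.
      by apply: truncn_itv; rewrite mulr_ge0.
    exists (g m k.+1); split=> //.
      by rewrite /g -natr1 mulrDl mul1r lerD2r.
    split=> [[l _ [/=]]|vk]; last first.
      by exists k => //; split => //=; rewrite in_itv/= ks.
    rewrite in_itv/= => /andP[ls sl].
    suff -> : l = k by [].
    apply/eqP; rewrite eqn_leq -[(l <= k)%N]ltnS -[(k <= l)%N]ltnS -!(ltr_nat R).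
    have lt_g a b : g m a < g m b -> a%:R < b%:R :> R.
      by rewrite /g ltr_pM2r// invr_gt0.
    by rewrite !lt_g// ?(le_lt_trans ls)// (le_lt_trans ks).
  apply/seteqP; split => -[s w] /=.
    move=> [s0 vi].
    have /nbhs_ballP[e /= e0 ve] := rw_right_continuous walk w s0.
    have einv : 0 <= e^-1 by rewrite invr_ge0 ltW.
    exists (Num.bound e^-1) => // m /= em.
    have [u [su um ->]] := BE m s w s0.
    rewrite ve// /ball/= distrC ger0_norm ?subr_ge0 ?ltW//.
    rewrite ltrBlDl (le_lt_trans um)// ltrD2l invf_plt ?posrE//.
    have /lt_le_trans -> // := archi_boundP einv.
    by rewrite ler_nat (leq_trans em).
  move=> [M _ hM].
  have s0 : 0 <= s.
    have [k _ [/= + _]] := hM M (leqnn M).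
    by rewrite in_itv/= => /andP[/(le_trans (g0 M k))].
  split=> //.
  have /nbhs_ballP[e /= e0 ve] := rw_right_continuous walk w s0.
  have einv : 0 <= e^-1 by rewrite invr_ge0 ltW.
  pose m := maxn M (Num.bound e^-1).
  have [u [su um Bu]] := BE m s w s0.
  rewrite -(Bu.1 (hM m (leq_maxl _ _))) ve// /ball/= distrC.
  rewrite ger0_norm ?subr_ge0 ?ltW//.
  rewrite ltrBlDl (le_lt_trans um)// ltrD2l invf_plt ?posrE//.
  have /lt_le_trans -> // := archi_boundP einv.
  by rewrite ler_nat leqW// leq_maxr.
apply: bigcup_measurable => M _; apply: bigcap_measurable => [|m _].
  by exists M => /=.
apply: bigcup_measurable => k _; apply: measurableX => //.
exact: (rw_measurable walk).
Qed.

(** * Translations, time blocks and Jensen's inequality *)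

Lemma lebesgue_measure_shift (R : realType) (c : R) (A : set R) : measurable A ->
  pushforward lebesgue_measure (fun x : R => x + c : measurableTypeR R) A =
  lebesgue_measure A.
Proof.
have mc : measurable_fun setT (fun x : R => x + c : measurableTypeR R).
  exact: measurable_funD.
move=> mA; apply/esym.
pose mc_mixin := isMeasurableFun.Build _ _ _ _ _ mc.
pose shift : {mfun _ >-> _} := HB.pack (fun x : R => x + c : measurableTypeR R) mc_mixin.
apply: (@lebesgue_measure_unique _ (pushforward lebesgue_measure shift)) => //=.
move=> _ [[a b]] _ <-.
rewrite /pushforward.
have -> : shift @^-1` [set` `]a, b]] = [set` `](a - c), (b - c)]].
  by apply/seteqP; split => x; rewrite /= !in_itv/= ltrBlDr lerBrDr.
rewrite !lebesgue_measure_itv/= !lte_fin ltrD2r.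
by case: ifP => // _; rewrite -!EFinB; congr EFin; ring.
Qed.

Lemma integral_shift (R : realType) (g : R -> \bar R) (a b c : R) :
  measurable_fun setT g -> (forall x, 0 <= g x)%E ->
  (\int[lebesgue_measure]_(x in `[(a + c)%R, (b + c)%R[) g x =
   \int[lebesgue_measure]_(x in `[a, b[) g (x + c)%R)%E.
Proof.
move=> mg g0.
have mc : measurable_fun setT (fun x : R => x + c : measurableTypeR R).
  exact: measurable_funD.
have -> : `[a, b[%classic =
    (fun x : R => x + c : measurableTypeR R) @^-1` `[(a + c)%R, (b + c)%R[.
  by apply/seteqP; split => x; rewrite /= !in_itv/= lerD2r ltrD2r.
transitivity (\int[pushforward lebesgue_measure
    (fun x : R => (x + c)%R : measurableTypeR R)]_(x in `[(a + c)%R, (b + c)%R[) g x)%E.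
  by apply: eq_measure_integral => A mA _; exact/esym/lebesgue_measure_shift.
by rewrite ge0_integral_pushforward//; exact: measurable_funTS.
Qed.

(** Translating all blocks onto the first one exhibits the time integral as an integral over offsets
    s of sums with spacing T; half-open blocks are disjoint. *)
Lemma integral_blocks (R : realType) (h : R -> R) (T : R) N :
  measurable_fun setT h -> (forall x, 0 <= h x) -> 0 <= T ->
  (\int[lebesgue_measure]_(s in `[0%R, (N%:R * T)%R[) (h s)%:E =
   \int[lebesgue_measure]_(s in `[0%R, T[) (\sum_(k < N) h (s + k%:R * T))%:E)%E.
Proof.
move=> mh h0 T0.
have mhE : measurable_fun setT (EFin \o h) by exact/measurable_EFinP.
have mshift (c : R) : measurable_fun setT (fun s : R => h (s + c)).
  apply: measurableT_comp => //.
  exact: measurable_funD.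
elim: N => [|N IH].
  rewrite mul0r set_itvco0 integral_set0.
  by under eq_integral do rewrite big_ord0; rewrite integral0.
have -> : `[0, N.+1%:R * T[%classic =
    `[0, N%:R * T[ `|` `[0 + N%:R * T, T + N%:R * T[.
  have NT : 0 <= N%:R * T by rewrite mulr_ge0.
  have NT' : N%:R * T <= N.+1%:R * T by rewrite ler_wpM2r// ler_nat.
  rewrite add0r (_ : T + N%:R * T = N.+1%:R * T); last by rewrite -natr1; ring.
  by rewrite -itv_bndbnd_setU// bnd_simp.
rewrite ge0_integral_setU//=; last 3 first.
- exact: measurable_funTS.
- by move=> x _; rewrite lee_fin.
- rewrite disj_set2E; apply/eqP/seteqP; split => x//= [].
  by rewrite !in_itv/= add0r => /andP[_ +] /andP[+ _]; case: ltP.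
rewrite IH (integral_shift _ _ _ mhE)//.
rewrite -ge0_integralD//=; last 4 first.
- by move=> x _; rewrite lee_fin sumr_ge0.
- apply: measurable_funTS; apply/measurable_EFinP.
  by apply: measurable_sum => k; exact: mshift.
- by move=> x _; rewrite lee_fin.
- by apply: measurable_funTS; apply/measurable_EFinP; exact: mshift.
by apply: eq_integral => x _; rewrite big_ord_recr/= EFinD.
Qed.

(** The tangent line of exp at the average a lies below exp, and its integral is exactly T exp a.
    The mass is T rather than 1, to fit an interval of offsets. *)
Lemma jensen_expR (d : measure_display) (Omega : measurableType d) (R : realType)
    (m : {measure set Omega -> \bar R}) (D : set Omega) (S : Omega -> R) (T B : R) :
  measurable D -> m D = T%:E -> 0 < T -> measurable_fun D S ->
  (forall x, D x -> `|S x| <= B) ->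
  ((expR (T^-1 * \int[m]_(x in D) S x))%:E <=
   (T^-1)%:E * \int[m]_(x in D) (expR (S x))%:E)%E.
Proof.
move=> mD mDT T0 mS SB.
have mDoo : (m D < +oo)%E by rewrite mDT ltry.
have bounded_int (u : Omega -> R) C : measurable_fun D u ->
    (forall x, D x -> `|u x| <= C) -> m.-integrable D (EFin \o u).
  move=> mu uC; apply: measurable_bounded_integrable => //.
  exists C; split; first exact: num_real.
  by move=> M CM x Dx /=; rewrite (le_trans (uC x Dx))// ltW.
have iS : m.-integrable D (EFin \o S) by exact: bounded_int SB.
have meS : measurable_fun D (fun x => expR (S x)) by apply: measurableT_comp.
have ieS : m.-integrable D (EFin \o (fun x => expR (S x))).
  apply: (bounded_int _ (expR B)) => // x Dx.
  by rewrite ger0_norm ?expR_ge0// ler_expR (le_trans (ler_norm _))// SB.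
have -> : (\int[m]_(x in D) (expR (S x))%:E)%E = (\int[m]_(x in D) expR (S x))%:E.
  by rewrite /Rintegral fineK//; exact: (integrable_fin_num mD ieS).
rewrite -EFinM lee_fin ler_pdivlMl//.
set a := T^-1 * _.
have aT : \int[m]_(x in D) S x = T * a by rewrite /a mulrA divff ?mul1r// gt_eqF.
have icst : m.-integrable D (EFin \o cst (1 - a)).
  exact: (bounded_int _ `|1 - a|).
have iaS : m.-integrable D (EFin \o (fun x => 1 - a + S x)).
  apply: (bounded_int _ (`|1 - a| + B)) => [|x Dx]; first exact: measurable_funD.
  by rewrite (le_trans (ler_normD _ _))// lerD2l SB.
have -> : T * expR a = \int[m]_(x in D) (expR a * (1 - a + S x)).
  rewrite RintegralZl// RintegralD// Rintegral_cst// mDT aT/=; ring.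
apply: le_Rintegral => // [|x Dx].
  apply: (bounded_int _ (expR a * (`|1 - a| + B))) => [|x Dx].
    by apply: measurable_funM => //; exact: measurable_funD.
  rewrite normrM ger0_norm ?expR_ge0// ler_wpM2l ?expR_ge0//.
  by rewrite (le_trans (ler_normD _ _))// lerD2l SB.
have -> : expR (S x) = expR a * expR (S x - a) by rewrite -expRD; congr expR; ring.
rewrite ler_wpM2l ?expR_ge0// (le_trans _ (expR_ge1Dx _))//.
by rewrite addrA addrAC.
Qed.

Section walk_weight.
Context {R : realType} {n : nat} {d : measure_display} {Omega : measurableType d}.
Variables (L : 'M[R]_n) (phi : 'rV[R]_n) (P : probability Omega R).
Variables (v : R -> Omega -> 'I_n) (f : R -> 'I_n -> R).
Hypothesis walk : random_walk L phi P v.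
Hypothesis f01 : forall s i, 0 <= s -> 0 <= f s i <= 1.
Hypothesis f_meas : forall j, measurable_fun (`[0, +oo[ : set R) (fun s => f s j).

(* Extension by zero to negative times, where nothing is known about f and v. *)
Definition reward s w : R := if 0 <= s then f s (v s w) else 0.

Lemma reward_ge0 s w : 0 <= reward s w.
Proof. by rewrite /reward; case: ifPn => // s0; case/andP: (f01 (v s w) s0). Qed.

Lemma reward_le1 s w : reward s w <= 1.
Proof. by rewrite /reward; case: ifPn => // s0; case/andP: (f01 (v s w) s0). Qed.

(** Joint measurability in time and outcome is what Tonelli's theorem needs; finitely many states
    reduce it to the graphs of the walk. *)
Lemma measurable_reward2 : measurable_fun setT (fun z : R * Omega => reward z.1 z.2).
Proof.
pose B i := [set z : R * Omega | 0 <= z.1 /\ v z.1 z.2 = i].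
pose g i := (fun s => f s i) \_ (`[0, +oo[ : set R).
have -> : (fun z : R * Omega => reward z.1 z.2) =
    fun z => \sum_i g i z.1 * \1_(B i) z.
  apply/funext => -[s w] /=; rewrite /reward; case: ifPn => s0.
    rewrite (bigD1 (v s w))//= [X in _ + X]big1 => [|i /eqP iv].
      rewrite indicE mem_set//= mulr1 addr0 /g patchE.
      by rewrite mem_set//= in_itv/= s0.
    by rewrite indicE memNset ?mulr0// => -[_ /= /esym].
  rewrite big1// => i _; rewrite indicE memNset ?mulr0// => -[/= s0'].
  by rewrite s0' in s0.
apply: measurable_sum => i; apply: measurable_funM.
  apply: (@measurableT_comp _ _ _ _ _ _ (g i)); last exact: measurable_fst.
  by apply/(measurable_restrictT _ _).1 => //; exact: f_meas.
by apply: measurable_indic; exact: (measurable_walk_graph i walk).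
Qed.

Lemma measurable_reward w : measurable_fun setT (reward^~ w).
Proof.
exact: (measurableT_comp measurable_reward2 (pair2_measurable w)).
Qed.

Lemma weightE t w :
  (weight f v t w)%:E = (\int[lebesgue_measure]_(s in `[0%R, t]) (reward s w)%:E)%E.
Proof.
have -> : weight f v t w = \int[lebesgue_measure]_(s in `[0, t]) reward s w.
  apply: eq_Rintegral => s; rewrite inE/= in_itv/= => /andP[s0 _].
  by rewrite /reward s0.
rewrite /Rintegral fineK//.
apply: (@integrable_fin_num _ _ _ lebesgue_measure) => //.
apply: measurable_bounded_integrable => //.
- by rewrite /= lebesgue_measure_itv/=; case: ifP => // _; rewrite ltry.
- by apply: measurable_funTS; exact: measurable_reward.
- exists 1; split; first exact: num_real.
  move=> M M1 s _ /=; rewrite ger0_norm ?reward_ge0//.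
  by rewrite (le_trans (reward_le1 _ _))// ltW.
Qed.

Lemma measurable_weight t : measurable_fun setT (weight f v t).
Proof.
apply/measurable_EFinP.
have -> : EFin \o weight f v t = fun w =>
    (\int[lebesgue_measure]_s
      ((fun z : R * Omega => (\1_`[0%R, t] z.1 * reward z.1 z.2)%:E) (s, w)))%E.
  apply/funext => w /=; rewrite weightE integral_mkcond.
  apply: eq_integral => s _ /=; rewrite patchE indicE.
  by case: ifPn => _; rewrite ?mul1r ?mul0r.
apply: (measurable_fun_fubini_tonelli_G (m1 := lebesgue_measure)
    (fun z : R * Omega => (\1_`[0%R, t] z.1 * reward z.1 z.2)%:E)) => [|z].
  apply/measurable_EFinP; apply: measurable_funM; last exact: measurable_reward2.
  apply: (@measurableT_comp _ _ _ _ _ _ (\1_`[0%R, t] : R -> R)) => //.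
by rewrite lee_fin mulr_ge0// reward_ge0.
Qed.

Lemma le_weight s t w : s <= t -> weight f v s w <= weight f v t w.
Proof.
move=> st; rewrite -lee_fin !weightE; apply: ge0_subset_integral => //.
- by apply/measurable_EFinP; apply: measurable_funTS; exact: measurable_reward.
- by move=> x _; rewrite lee_fin reward_ge0.
- by move=> x /=; rewrite !in_itv/= => /andP[-> /le_trans]; apply.
Qed.

Lemma weight_blocks T N w : 0 <= T ->
  (weight f v (N%:R * T) w)%:E = (\int[lebesgue_measure]_(s in `[0%R, T[)
    (\sum_(k < N) reward (s + k%:R * T) w)%:E)%E.
Proof.
move=> T0; rewrite weightE -integral_itv_bndo_bndc; last first.
  by apply: measurable_funTS; apply/measurable_EFinP; exact: measurable_reward.
by rewrite integral_blocks//; [exact: measurable_reward|move=> s; exact: reward_ge0].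
Qed.

End walk_weight.

(** * Tail bounds *)

Lemma sum_along_nseq (R : realType) n (d : measure_display)
    (Omega : measurableType d) (f : R -> 'I_n -> R)
    (v : R -> Omega -> 'I_n) (u T : R) N w : 0 <= u -> 0 <= T ->
  sum_along f v u (nseq N T) w = \sum_(k < N) reward v f (u + k.+1%:R * T) w.
Proof.
move=> u0 T0; elim: N u u0 => [|N IH] u u0 /=; first by rewrite big_ord0.
rewrite big_ord_recl IH ?addr_ge0//= mul1r; congr (_ + _).
  by rewrite /reward addr_ge0.
apply: eq_bigr => k _; congr (reward _ _ _ _).
by rewrite -addrA -[T in RHS]mul1r /bump/= add1n -[k.+2%:R]natr1; ring.
Qed.

Section mgf_weight.
Context {R : realType} {n : nat} {d : measure_display} {Omega : measurableType d}.
Variables (L : 'M[R]_n) (pi phi : 'rV[R]_n) (P : probability Omega R).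
Variables (v : R -> Omega -> 'I_n) (f : R -> 'I_n -> R) (T mu theta : R).
Hypothesis walk : random_walk L phi P v.
Hypothesis L_gen : is_generator L.
Hypothesis phi_dist : is_distribution phi.
Hypothesis pi_gt0 : forall i, 0 < pi 0 i.
Hypothesis pi_sum : \sum_i pi 0 i = 1.
Hypothesis pi_stat : pi *m L = 0.
Hypothesis T_gt0 : 0 < T.
Hypothesis T_mix : forall i, \sum_j `|transition L T i j - pi 0 j| <= 4^-1.
Hypothesis theta_small : `|theta| <= 12^-1.
Hypothesis f01 : forall s i, 0 <= s -> 0 <= f s i <= 1.
Hypothesis f_mean : forall s, 0 <= s -> \sum_i pi 0 i * f s i = mu.
Hypothesis f_meas : forall j, measurable_fun (`[0, +oo[ : set R) (fun s => f s j).

Let T_ge0 : 0 <= T. Proof. exact: ltW. Qed.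

Let S N s w := \sum_(k < N.+1) reward v f (s + k%:R * T) w.

Let S_ge0 N s w : 0 <= S N s w.
Proof. by apply: sumr_ge0 => k _; exact: reward_ge0. Qed.

Let S_le N s w : S N s w <= N.+1%:R.
Proof.
rewrite -[leRHS]mulr1 mulr_natl -[X in _ <= _ *+ X]card_ord -sumr_const.
by apply: ler_sum => k _; exact: reward_le1.
Qed.

Let measurable_S2 N : measurable_fun setT (fun z : R * Omega => S N z.1 z.2).
Proof.
apply: measurable_sum => k.
have mk : measurable_fun setT (fun z : R * Omega => (z.1 + k%:R * T, z.2)).
  apply: measurable_fun_pair; last exact: measurable_snd.
  by apply: measurable_funD => //; exact: measurable_fst.
exact: (measurableT_comp (measurable_reward2 walk f_meas) mk).
Qed.

Let measurable_S N w : measurable_fun setT (S N ^~ w).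
Proof. exact: (measurableT_comp (measurable_S2 N) (pair2_measurable w)). Qed.

Let mgf_S N s : 0 <= s ->
  (\int[P]_w (expR (theta * S N s w))%:E <=
   (2 * norm_pi pi phi * expR (N.+1%:R * ((theta + 5 * theta ^+ 2) * mu)))%:E)%E.
Proof.
move=> s0.
have l0 : all (>= 0) (s :: nseq N T) by rewrite /= s0 all_nseq T_ge0 orbT.
have SE w : S N s w = sum_along f v 0 (s :: nseq N T) w.
  rewrite /= add0r sum_along_nseq// /S big_ord_recl mul0r addr0.
  by congr (_ + _); rewrite /reward s0.
under eq_integral do rewrite SE.
rewrite (expectation_mgf_along f theta walk L_gen l0) lee_fin.
exact: mgf_along_le.
Qed.

(** Jensen is applied path by path, Tonelli exchanges offsets and outcomes, and [mgf_S] is uniform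
    in the offset, so averaging loses nothing. *)
Lemma mgf_weight_le N :
  (\int[P]_w (expR (theta / T * weight f v (N.+1%:R * T) w))%:E <=
   (2 * norm_pi pi phi * expR (N.+1%:R * ((theta + 5 * theta ^+ 2) * mu)))%:E)%E.
Proof.
set C := 2 * _ * _.
pose D : set R := `[0, T[%classic.
have lD : lebesgue_measure D = T%:E.
  by rewrite /D lebesgue_measure_itv/= lte_fin T_gt0 sube0.
have lDoo : (lebesgue_measure D < +oo)%E by rewrite lD ltry.
have mD : measurable D by exact: measurable_itv.
pose F (z : R * Omega) := (\1_D z.1 * expR (theta * S N z.1 z.2))%:E.
have mF : measurable_fun setT F.
  apply/measurable_EFinP; apply: measurable_funM.
    by apply: (@measurableT_comp _ _ _ _ _ _ (\1_D : R -> R)) => //.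
  by apply: measurableT_comp => //; apply: measurable_funM => //.
have F0 z : (0 <= F z)%E by rewrite lee_fin mulr_ge0 ?expR_ge0.
have mG : measurable_fun setT (fun w => \int[lebesgue_measure]_s F (s, w))%E.
  exact: (measurable_fun_fubini_tonelli_G (m1 := lebesgue_measure) F mF F0).
have FE w : (\int[lebesgue_measure]_(s in D) (expR (theta * S N s w))%:E =
    \int[lebesgue_measure]_s F (s, w))%E.
  rewrite integral_mkcond; apply: eq_integral => s _ /=.
  by rewrite patchE /F indicE; case: ifPn => _ /=; rewrite ?mul1r ?mul0r.
have jensen w : ((expR (theta / T * weight f v (N.+1%:R * T) w))%:E <=
    (T^-1)%:E * \int[lebesgue_measure]_s F (s, w))%E.
  rewrite -FE.
  have iS : lebesgue_measure.-integrable D (EFin \o (S N ^~ w)).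
    apply: measurable_bounded_integrable => //.
      apply: measurable_funTS; exact: measurable_S.
    exists N.+1%:R; split; first exact: num_real.
    move=> M NM s _ /=; rewrite ger0_norm//.
    by rewrite (le_trans (S_le N s w))// ltW.
  have -> : theta / T * weight f v (N.+1%:R * T) w =
      T^-1 * \int[lebesgue_measure]_(s in D) (theta * S N s w).
    rewrite RintegralZl// mulrA [T^-1 * _]mulrC; congr (_ * _).
    apply: EFin_inj; rewrite (weight_blocks walk)// /Rintegral fineK//.
    by apply: (@integrable_fin_num _ _ _ lebesgue_measure) => //.
  apply: (@jensen_expR _ _ _ lebesgue_measure D _ T (`|theta| * N.+1%:R)) => //.
    by apply: measurable_funTS; apply: measurable_funM => //; exact: measurable_S.
  by move=> s _; rewrite normrM ler_wpM2l// ger0_norm.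
apply: (@le_trans _ _ (\int[P]_w ((T^-1)%:E * \int[lebesgue_measure]_s F (s, w))))%E.
  apply: ge0_le_integral => //=.
  - apply/measurable_EFinP; apply: measurableT_comp => //; apply: measurable_funM => //.
    exact: (measurable_weight walk f01 f_meas).
  - exact: emeasurable_funM.
rewrite ge0_integralZl//=; [|by move=> w _; exact: integral_ge0|
  by rewrite lee_fin invr_ge0].
rewrite -(fubini_tonelli (m1 := lebesgue_measure) (m2 := P) F mF F0).
rewrite lee_pdivrMl//.
have C0 : 0 <= C by rewrite !mulr_ge0 ?sqrtr_ge0 ?expR_ge0.
apply: (@le_trans _ _ (\int[lebesgue_measure]_s ((cst C%:E) \_ D) s))%E; last first.
  by rewrite -integral_mkcond integral_cst//= lD muleC.
apply: ge0_le_integral => //=.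
- by move=> s _; exact: integral_ge0.
- exact: (measurable_fun_fubini_tonelli_F (m2 := P) F mF F0).
- by apply/(measurable_restrictT _ _).1 => //; exact: measurable_cst.
- move=> s _; rewrite patchE; case: ifPn => sD.
    have s0 : 0 <= s by move: sD; rewrite inE /D/= in_itv/= => /andP[].
    apply: le_trans (mgf_S N s0); rewrite le_eqVlt; apply/orP; left; apply/eqP.
    by apply: eq_integral => w _; rewrite /F indicE/= sD mul1r.
  rewrite integral0_eq// => w _.
  by rewrite /F indicE/= (negPf sD) mul0r.
Qed.

Let mu01 : 0 <= mu <= 1.
Proof.
rewrite -(f_mean (lexx 0)); apply: mean_itv01 => // i; last exact: f01.
exact: ltW.
Qed.

(** A general event with a lower bound on the exponent serves both tails, whatever the sign of
    theta. *)
Let markov_weight N (A : set Omega) (a : R) : measurable A ->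
  (forall w, A w -> a <= theta / T * weight f v (N.+1%:R * T) w) ->
  (P A <= (2 * norm_pi pi phi *
    expR (N.+1%:R * ((theta + 5 * theta ^+ 2) * mu) - a))%:E)%E.
Proof.
move=> mA Aa.
rewrite expRD expRN mulrA EFinM muleC lee_pdivlMl ?expR_gt0//.
apply: le_trans (mgf_weight_le N).
have mE : measurable_fun setT
    (fun w => (expR (theta / T * weight f v (N.+1%:R * T) w))%:E).
  apply/measurable_EFinP; apply: measurableT_comp => //; apply: measurable_funM => //.
  exact: (measurable_weight walk f01 f_meas).
apply: (@le_trans _ _ (\int[P]_(w in A)
    (expR (theta / T * weight f v (N.+1%:R * T) w))%:E)%E); last first.
  by apply: ge0_subset_integral => // w _; rewrite lee_fin expR_ge0.
rewrite -integral_cst//; apply: ge0_le_integral => //.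
- by move=> w _; rewrite lee_fin expR_ge0.
- exact: measurable_funTS.
- by move=> w Aw; rewrite lee_fin ler_expR Aa.
Qed.

(** The time is rounded up to whole blocks, which can only increase the weight; the extra block
    costs (theta + 5 theta^2) mu <= 1, the 1 in the exponent. *)
Lemma upper_tail t delta : 0 <= t -> 0 <= theta ->
  (P [set w | ((1 + delta) * mu * t <= weight f v t w)%R] <=
   (2 * norm_pi pi phi *
     expR (1 - mu * (t / T) * (theta * delta - 5 * theta ^+ 2)))%:E)%E.
Proof.
move=> t0 theta0; have /andP[mu0 mu1] := mu01.
have theta1 : theta <= 12^-1 by rewrite (le_trans (ler_norm _)).
set tau := t / T; have tau0 : 0 <= tau by rewrite divr_ge0.
pose N := Num.truncn tau.
have /andP[Ntau tauN] : N%:R <= tau < N.+1%:R by exact: truncn_itv.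
apply: (@le_trans _ _ _ _ _ (markov_weight (N := N)
    (a := theta * (1 + delta) * mu * tau) _ _)).
- rewrite -[X in measurable X]setTI.
  rewrite [X in _ `&` X](_ : _ = weight f v t @^-1` `[((1 + delta) * mu * t)%R, +oo[).
    by apply: (measurable_weight walk f01 f_meas).
  by apply/seteqP; split => w /=; rewrite in_itv/= andbT.
- move=> w /= wA.
  have -> : theta * (1 + delta) * mu * tau = theta / T * ((1 + delta) * mu * t).
    by rewrite /tau; ring.
  rewrite ler_wpM2l ?divr_ge0// (le_trans wA)// (le_weight walk)//.
  by rewrite -ler_pdivrMr// ltW.
- rewrite lee_fin ler_wpM2l ?mulr_ge0 ?sqrtr_ge0// ler_expR.
  have c0 : 0 <= (theta + 5 * theta ^+ 2) * mu.
    by rewrite mulr_ge0// addr_ge0// mulr_ge0// sqr_ge0.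
  have c1 : (theta + 5 * theta ^+ 2) * mu <= 1.
    rewrite -[leRHS]mulr1 ler_pM// ?addr_ge0 ?mulr_ge0 ?sqr_ge0//.
    have : theta * theta <= 12^-1 * 12^-1 by rewrite ler_pM.
    by rewrite expr2; lra.
  have : N.+1%:R * ((theta + 5 * theta ^+ 2) * mu) <=
      (tau + 1) * ((theta + 5 * theta ^+ 2) * mu).
    by rewrite ler_wpM2r// -natr1 lerD2r.
  by move: c1; lra.
Qed.

(** Here the time is rounded down, and T <= t provides at least one block. Since -1/12 <= theta <= 0
    makes theta + 5 theta^2 nonpositive, the lost fraction of a block again costs at most 1. *)
Lemma lower_tail t delta : T <= t -> theta <= 0 ->
  (P [set w | (weight f v t w <= (1 - delta) * mu * t)%R] <=
   (2 * norm_pi pi phi *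
     expR (1 - mu * (t / T) * (- theta * delta - 5 * theta ^+ 2)))%:E)%E.
Proof.
move=> Tt theta0; have /andP[mu0 mu1] := mu01.
have theta1 : - 12^-1 <= theta by move: theta_small; rewrite ler_norml => /andP[].
set tau := t / T.
have tau1 : 1 <= tau by rewrite /tau ler_pdivlMr// mul1r.
have [N NE] : exists N, Num.truncn tau = N.+1.
  have tau0 : 0 <= tau by rewrite (le_trans _ tau1).
  case E : (Num.truncn tau) => [|N]; last by exists N.
  by have := truncn_itv tau0; rewrite E => /andP[_]; rewrite ltNge tau1.
have /andP[Ntau tauN] : N.+1%:R <= tau < N.+2%:R.
  by rewrite -NE; apply: truncn_itv; lra.
apply: (@le_trans _ _ _ _ _ (markov_weight (N := N)
    (a := theta * (1 - delta) * mu * tau) _ _)).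
- rewrite -[X in measurable X]setTI.
  rewrite [X in _ `&` X](_ : _ = weight f v t @^-1` `]-oo, ((1 - delta) * mu * t)%R]).
    by apply: (measurable_weight walk f01 f_meas).
  by apply/seteqP; split => w /=; rewrite in_itv.
- move=> w /= wA.
  have -> : theta * (1 - delta) * mu * tau = theta / T * ((1 - delta) * mu * t).
    by rewrite /tau; ring.
  rewrite ler_wnM2l ?mulr_le0_ge0 ?invr_ge0// (le_trans _ wA)// (le_weight walk)//.
  by rewrite -ler_pdivlMr.
- rewrite lee_fin ler_wpM2l ?mulr_ge0 ?sqrtr_ge0// ler_expR.
  have sq : theta ^+ 2 <= - theta * 12^-1.
    have : 0 <= - theta * (theta + 12^-1) by rewrite mulr_ge0; lra.
    by rewrite expr2; lra.
  have c0 : 0 <= - (theta + 5 * theta ^+ 2) * mu.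
    by rewrite mulr_ge0//; lra.
  have c1 : - (theta + 5 * theta ^+ 2) * mu <= 1.
    rewrite -[leRHS]mulr1 ler_pM//; have := sqr_ge0 theta; lra.
  have : (tau - 1) * (- (theta + 5 * theta ^+ 2) * mu) <=
      N.+1%:R * (- (theta + 5 * theta ^+ 2) * mu).
    by rewrite ler_wpM2r//; move: tauN; rewrite -natr1; lra.
  by move: c1; lra.
Qed.

End mgf_weight.

Theorem theorem3p5 (R : realType) :
  exists c : R,
  forall (n : nat) (L : 'M[R]_n) (pi : 'rV[R]_n) (eps : R) (phi : 'rV[R]_n)
    (d : measure_display) (Omega : measurableType d) (P : probability Omega R)
    (v : R -> Omega -> 'I_n) (f : R -> 'I_n -> R) (mu : R),
  (2 <= n)%N ->
  is_generator L -> ergodic L -> is_stationary L pi ->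
  0 < eps -> eps <= 8^-1 ->
  is_distribution phi -> random_walk L phi P v ->
  (forall s i, 0 <= s -> 0 <= f s i <= 1) ->
  (forall s, 0 <= s -> \sum_i pi 0 i * f s i = mu) ->
  (forall j, measurable_fun (`[0, +oo[ : set R) (fun s => f s j)) ->
  let T := mixing_time L pi eps in
  let X := weight f v in
  forall t delta : R, 0 <= t ->
  [/\ (0 <= delta <= 1 ->
       (P [set w | (X t w >= (1 + delta) * mu * t)%R] <=
        (c * norm_pi pi phi * expR (- (delta ^+ 2 * mu * t / (72 * T))))%R%:E)%E),
      (1 < delta ->
       (P [set w | (X t w >= (1 + delta) * mu * t)%R] <=
        (c * norm_pi pi phi * expR (- (delta * mu * t / (72 * T))))%R%:E)%E)
    & (0 <= delta <= 1 ->
       (P [set w | (X t w <= (1 - delta) * mu * t)%R] <=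
        (c * norm_pi pi phi * expR (- (delta ^+ 2 * mu * t / (72 * T))))%R%:E)%E)].
Proof.
(* The 2 comes from the exponential moment, the e from rounding to whole blocks. *)
exists (2 * expR 1) => n L pi eps phi d Omega P v f mu n2 L_gen erg st eps0 eps8.
move=> phi_dist walk f01 f_mean f_meas T X t delta t0.
have pi_gt0 := stationary_gt0 L_gen erg st.
have [[_ pi_sum] pi_stat] := st.
have phi1 := norm_pi_ge1 pi_gt0 pi_sum phi_dist.
have phi0 : 0 <= norm_pi pi phi by exact: sqrtr_ge0.
have mu01 : 0 <= mu <= 1.
  rewrite -(f_mean 0 (lexx 0)); apply: mean_itv01 => // i; last exact: f01.
  exact: ltW.
have /andP[mu0 mu1] := mu01.
have mX := measurable_weight walk f01 f_meas t.
have trivial_bound (A : set Omega) (E : R) : measurable A -> E <= 1 ->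
    (P A <= (2 * expR 1 * norm_pi pi phi * expR (- E))%:E)%E.
  move=> mA E1; apply: (@le_trans _ _ 1%E); first exact: probability_le1.
  rewrite lee_fin.
  have -> : 2 * expR 1 * norm_pi pi phi * expR (- E) =
      2 * norm_pi pi phi * expR (1 - E) by rewrite expRD; ring.
  rewrite -[leLHS]mulr1 ler_pM//; first by lra.
  by rewrite -[leLHS]expR0 ler_expR subr_ge0.
have widen (p : \bar R) (x E : R) : x <= 1 - E ->
    (p <= (2 * norm_pi pi phi * expR x)%:E)%E ->
    (p <= (2 * expR 1 * norm_pi pi phi * expR (- E))%:E)%E.
  move=> xE /le_trans; apply; rewrite lee_fin.
  have -> : 2 * expR 1 * norm_pi pi phi * expR (- E) =
      2 * norm_pi pi phi * expR (1 - E) by rewrite expRD; ring.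
  by rewrite ler_wpM2l ?mulr_ge0// ler_expR.
have mge a : measurable [set w | X t w >= a].
  rewrite -[X in measurable X]setTI.
  rewrite [Y in _ `&` Y](_ : _ = X t @^-1` `[a, +oo[); first exact: mX.
  by apply/seteqP; split => w /=; rewrite in_itv/= andbT.
have mle a : measurable [set w | X t w <= a].
  rewrite -[X in measurable X]setTI.
  rewrite [Y in _ `&` Y](_ : _ = X t @^-1` `]-oo, a]); first exact: mX.
  by apply/seteqP; split => w /=; rewrite in_itv.
pose mixed := [set t : R | 0 <= t /\ forall x : 'rV[R]_n, is_distribution x ->
      tv_dist (x *m transition L t) pi <= eps].
have T_ge0 : 0 <= T.
  have [m0|/set0P [s ms]] := eqVneq mixed set0.
    by rewrite /T /mixing_time -/mixed m0 inf0.
  by apply: lb_le_inf => [|u []]; first by exists s.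
(* For T = 0 the exponents are divided by zero, hence vanish. *)
have [T0|T_neq0] := eqVneq T 0.
  by split=> _; apply: trivial_bound => //; rewrite T0 mulr0 invr0 mulr0 ler01.
have T_gt0 : 0 < T by rewrite lt_neqAle eq_sym T_neq0.
(* T <> 0 also shows that the set is nonempty, the infimum of the empty set being 0 by convention;
   the gap given to [inf_adherent] is T itself. *)
have [T' [T'_ge0 T'_mix] T'_lt] : exists2 T', mixed T' & T' < 2 * T.
  have hinf : has_inf mixed.
    split; last by exists 0 => u [].
    apply/set0P/eqP => m0.
    by move: T_neq0; rewrite /T /mixing_time -/mixed m0 inf0 eqxx.
  have [u mu_ uT] := inf_adherent T_gt0 hinf.
  exists u => //; move: uT; rewrite -/(mixing_time L pi eps) -/T; lra.
have TT' : T <= T'.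
  by apply: ge_inf => //; exists 0 => u [].
have T'_gt0 : 0 < T' by exact: lt_le_trans TT'.
have mix i : \sum_j `|transition L T' i j - pi 0 j| <= 4^-1.
  rewrite (le_trans (mixing_rows T'_mix i))//.
  by move: eps8; lra.
set tau := t / T'.
have tau0 : 0 <= tau by rewrite divr_ge0.
have T_tau : t / (72 * T) <= tau / 36.
  rewrite ler_pdivrMr; last by rewrite mulr_gt0.
  have -> : tau / 36 * (72 * T) = tau * (2 * T) by field.
  by rewrite -[leLHS](divfK (lt0r_neq0 T'_gt0)) ler_wpM2l// ltW.
have expE a : 0 <= a -> a * mu * t / (72 * T) <= mu * tau * (a / 36).
  move=> a0; have -> : a * mu * t / (72 * T) = a * mu * (t / (72 * T)) by rewrite mulrA.
  have -> : mu * tau * (a / 36) = a * mu * (tau / 36) by ring.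
  by rewrite ler_wpM2l// mulr_ge0.
have upper theta (th : `|theta| <= 12^-1) := upper_tail walk L_gen phi_dist
  pi_gt0 pi_sum pi_stat T'_gt0 mix th f01 f_mean f_meas delta t0.
have lower theta (th : `|theta| <= 12^-1) := lower_tail walk L_gen phi_dist
  pi_gt0 pi_sum pi_stat T'_gt0 mix th f01 f_mean f_meas delta.
have mutau : 0 <= mu * tau by rewrite mulr_ge0.
split.
- move=> /andP[d0 d1].
  have th : `|delta / 12| <= 12^-1 by rewrite ger0_norm; lra.
  apply: (widen _ _ _ _ (upper _ th _)); last by lra.
  rewrite lerD2l lerN2 (le_trans (expE _ (sqr_ge0 _)))// ler_wpM2l//.
  by have := sqr_ge0 delta; rewrite expr_div_n; lra.
(* For delta > 1, theta stays at its cap 1/12, and delta/12 - 5/144 >= delta/36. *)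
- move=> d1.
  have th : `|12^-1 : R| <= 12^-1 by rewrite ger0_norm.
  apply: (widen _ _ _ _ (upper _ th _)); last by lra.
  rewrite lerD2l lerN2 (le_trans (expE delta _)) ?ler_wpM2l//; lra.
- move=> /andP[d0 d1].
  (* Below T' there is no whole block to round down to, but the exponent is then at most 1 and the
     bound is trivial. *)
  have [tT|T't] := ltP t T'.
    apply: trivial_bound => //.
    rewrite (le_trans (expE _ (sqr_ge0 _)))//.
    have tau1 : tau <= 1 by rewrite ler_pdivrMr// mul1r ltW.
    have d2 : delta ^+ 2 <= 1 by rewrite expr_le1.
    rewrite -[leRHS]mulr1 ler_pM//.
    + by rewrite divr_ge0 ?sqr_ge0.
    + by rewrite -[leRHS]mulr1 ler_pM.
    + by lra.
  have th : `|- (delta / 12)| <= 12^-1 by rewrite normrN ger0_norm; lra.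
  apply: (widen _ _ _ _ (lower _ _ th T't _)); last by lra.
  rewrite lerD2l lerN2 (le_trans (expE _ (sqr_ge0 _)))// ler_wpM2l//.
  by have := sqr_ge0 delta; rewrite sqrrN expr_div_n opprK; lra.
Qed.
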